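(* Let $n\ge1$ and $d,r_1,r_2$ be integers with $r_1\ge d$, $r_2\ge d$ and $d\ge3$. Then the scheme representing $\mathrm{Bilin}_{d,d,d}^{r_1,r_2}(\mathbb{A}^n)$ is reducible.
   Context: Let $k$ be an infinite algebraically closed field, $S=k[x_1,\dots,x_n]$, $\mathbb{A}^n=\operatorname{Spec}S$, $S_A=S\otimes_kA$ for a $k$-algebra $A$. The functor $\mathrm{Bilin}_{d,d,d}^{r_1,r_2}(\mathbb{A}^n)\colon(\mathrm{Sch}/k)^{op}\to\mathrm{Set}$ is given on affine schemes $\operatorname{Spec}A$ by the set of triples $[p_1,p_2,\pi]$ of $S_A$-linear surjections $p_i\colon S_A^{\oplus r_i}\twoheadrightarrow M_i$ ($i=1,2$) and $\pi\colon M_1\otimes_{S_A}M_2\twoheadrightarrow M_3$ with $M_j$ locally free of rank $d$ over $A$ ($j=1,2,3$), surjections with equal kernels being identified (and analogously with quasicoherent sheaves over an arbitrary $k$-scheme). It is representable by a $k$-scheme, a closed subscheme of a product of Quot schemes of points. Reducible means that the underlying topological space of the representing scheme is not irreducible. *)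

(* Defs.v *)
From HB Require Import structures.
From mathcomp.multinomials Require Import mpoly.
From mathcomp Require Import all_boot all_order all_algebra ring.
From mathcomp Require Import boolp classical_sets topology.

Set Implicit Arguments.
Unset Strict Implicit.
Unset Printing Implicit Defensive.

Import GRing.Theory.
Local Open Scope classical_set_scope.
Local Open Scope ring_scope.
Local Open Scope quotient_scope.

Record opens (X : topologicalType) := Opens {
  oset :> set X;
  oset_open : open oset
}.

Definition opensI (X : topologicalType) (U V : opens X) : opens X :=
  Opens (openI (oset_open U) (oset_open V)).

(* Sections over the empty set form the zero ring, whence comPzRingType. *)
Record ringed_space := RingedSpace {
  rs_top :> topologicalType;
  sec : opens rs_top -> comPzRingType;
  res : forall U V : opens rs_top, V `<=` U -> {rmorphism sec U -> sec V};
  res_id : forall (U : opens rs_top) (h : U `<=` U) (s : sec U), res h s = s;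
  res_comp : forall (U V W : opens rs_top)
      (hVU : V `<=` U) (hWV : W `<=` V) (hWU : W `<=` U) (s : sec U),
    res hWV (res hVU s) = res hWU s;
  sec_glue : forall (I : Type) (U : opens rs_top) (F : I -> opens rs_top)
      (hF : forall i, F i `<=` U) (s : forall i, sec (F i)),
    U `<=` \bigcup_i F i ->
    (forall i j (W : opens rs_top) (hi : W `<=` F i) (hj : W `<=` F j),
       res hi (s i) = res hj (s j)) ->
    exists! t : sec U, forall i, res (hF i) t = s i
}.

(* "The germ of s at x is invertible in the stalk at x." *)
Definition germ_unit (X : ringed_space) (U : opens X) (s : sec U) (x : X) :=
  exists (W : opens X) (h : W `<=` U) (t : sec W), oset W x /\ res h s * t = 1.

Definition preim (X Y : topologicalType) (f : X -> Y) (cf : continuous f)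
    (V : opens Y) : opens X :=
  Opens (open_comp (fun x _ => cf x) (oset_open V)).

(* The last field says that the maps on stalks O_{Y,f(x)} -> O_{X,x} are local:
   a germ whose pull-back is invertible is itself invertible. *)
Record morphism (X Y : ringed_space) := Morphism {
  mfun :> X -> Y;
  mcont : continuous mfun;
  mpull : forall V : opens Y, {rmorphism sec V -> sec (preim mcont V)};
  mpull_res : forall (V W : opens Y) (h : W `<=` V)
      (h' : preim mcont W `<=` preim mcont V) (s : sec V),
    res h' (mpull V s) = mpull W (res h s);
  mlocal : forall (V : opens Y) (s : sec V) (x : X), oset V (mfun x) ->
    germ_unit (mpull V s) x -> germ_unit s (mfun x)
}.

(* Equality of morphisms; sections are compared after restriction because
   f^-1(V) and g^-1(V) are only propositionally equal. *)
Definition morphism_eq (X Y : ringed_space) (f g : morphism X Y) :=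
  (forall x, f x = g x) /\
  forall (V : opens Y) (s : sec V) (W : opens X)
    (hf : W `<=` preim (@mcont _ _ f) V) (hg : W `<=` preim (@mcont _ _ g) V),
    res hf (mpull f V s) = res hg (mpull g V s).

Section Composition.
Variables (X Y Z : ringed_space) (g : morphism Y Z) (f : morphism X Y).

Let comp_cont : continuous (g \o f).
Proof. by move=> x; apply: continuous_comp; apply: mcont. Qed.

Let preim_comp (V : opens Z) :
  preim comp_cont V `<=` preim (@mcont _ _ f) (preim (@mcont _ _ g) V).
Proof. by []. Qed.

Let comp_pull (V : opens Z) : {rmorphism sec V -> sec (preim comp_cont V)} :=
  (res (@preim_comp V) \o mpull f _ \o mpull g V)%FUN.

Let comp_pull_res (V W : opens Z) (h : W `<=` V)
    (h' : preim comp_cont W `<=` preim comp_cont V) (s : sec V) :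
  res h' (comp_pull V s) = comp_pull W (res h s).
Proof.
rewrite /=.
have hg : preim (@mcont _ _ g) W `<=` preim (@mcont _ _ g) V by move=> y /h.
have hf : preim (@mcont _ _ f) (preim (@mcont _ _ g) W) `<=`
          preim (@mcont _ _ f) (preim (@mcont _ _ g) V) by move=> y /hg.
rewrite -(mpull_res h hg) -(mpull_res hg hf).
rewrite (res_comp _ _ (subset_trans h' (@preim_comp V))).
exact/esym/res_comp.
Qed.

Let comp_local (V : opens Z) (s : sec V) (x : X) : oset V ((g \o f) x) ->
  germ_unit (comp_pull V s) x -> germ_unit s ((g \o f) x).
Proof.
move=> Vx [W [h [t [Wx e]]]]; apply: mlocal => //; apply: mlocal => //.
exists W, (subset_trans h (@preim_comp V)), t; split=> //.
by rewrite -e /=; congr (_ * _); apply/esym/res_comp.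
Qed.

Definition morphism_comp : morphism X Z :=
  Morphism comp_pull_res comp_local.

End Composition.

Section Identity.
Variable X : ringed_space.

Let id_cont : continuous (@idfun X).
Proof. by move=> x; apply: cvg_id. Qed.

Let id_preim (V : opens X) : preim id_cont V `<=` V.
Proof. by []. Qed.

Let id_pull (V : opens X) : {rmorphism sec V -> sec (preim id_cont V)} :=
  res (@id_preim V).

Let id_pull_res (V W : opens X) (h : W `<=` V)
    (h' : preim id_cont W `<=` preim id_cont V) (s : sec V) :
  res h' (id_pull V s) = id_pull W (res h s).
Proof.
have hWV : preim id_cont W `<=` V by move=> x; apply: h.
exact: etrans (res_comp _ _ hWV s) (esym (res_comp _ _ hWV s)).
Qed.

Let id_local (V : opens X) (s : sec V) (x : X) : oset V x ->
  germ_unit (id_pull V s) x -> germ_unit s x.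
Proof.
move=> Vx [W [h [t [Wx e]]]]; exists W, (subset_trans h (@id_preim V)), t.
by split=> //; rewrite -e; congr (_ * _); apply/esym/res_comp.
Qed.

Definition morphism_id : morphism X X := Morphism id_pull_res id_local.

Lemma id_pull_bij (V : opens X) : bijective (mpull morphism_id V).
Proof.
have h : V `<=` preim id_cont V by [].
exists (res h) => s.
  exact: etrans (res_comp _ _ (@subset_refl _ V) s) (res_id _ s).
exact: etrans (res_comp _ _ (@subset_refl _ (preim id_cont V)) s) (res_id _ s).
Qed.

End Identity.

(* An isomorphism of X onto an open subspace of Y. *)
Definition open_immersion (X Y : ringed_space) (j : morphism X Y) :=
  [/\ injective j,
      forall W : set X, open W -> open (j @` W) &
      forall V : opens Y, V `<=` range j -> bijective (mpull j V)].

Record spec (A : comNzRingType) := SpecPoint {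
  spec_pred : A -> bool;
  spec_idealr : idealr_closed spec_pred;
  spec_prime : prime_idealr_closed spec_pred
}.

Coercion spec_mem (A : comNzRingType) (p : spec A) : {pred A} := spec_pred p.

HB.instance Definition _ (A : comNzRingType) := gen_eqMixin (spec A).
HB.instance Definition _ (A : comNzRingType) := gen_choiceMixin (spec A).

Section SpecTheory.
Variable A : comNzRingType.
Implicit Types p q : spec A.

Lemma spec_eq p q : (forall a, (a \in p) = (a \in q)) -> p = q.
Proof.
case: p q => [P iP pP] [Q iQ pQ] /= h.
have e : P = Q by apply: funext => a; apply: h.
by case: _ / e in iQ pQ h *; congr SpecPoint; apply: Prop_irrelevance.
Qed.

Lemma spec1 p : 1 \notin p.
Proof. by case: (spec_idealr p). Qed.

Lemma spec0 p : 0 \in p.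
Proof. by case: (spec_idealr p). Qed.

Lemma specMl p a u : u \in p -> a * u \in p.
Proof.
by move=> up; case: (spec_idealr p) => h0 _ /(_ a u 0 up h0); rewrite addr0.
Qed.

Lemma specM p a b : (a * b \in p) = (a \in p) || (b \in p).
Proof.
apply/idP/orP => [/(@spec_prime _ p)/orP //|[ap|bp]]; last exact: specMl.
by rewrite mulrC; apply: specMl.
Qed.

Lemma specMn p a b : a \notin p -> b \notin p -> a * b \notin p.
Proof. by move=> ha hb; rewrite specM negb_or ha. Qed.

(* Zariski topology: open sets are the unions of basic open sets D(f). *)
Definition zariski_open (U : set (spec A)) :=
  exists E : set A, U = [set p : spec A | exists2 f, E f & f \notin p].

Lemma zariski_openT : zariski_open setT.
Proof.
by exists [set 1]; apply/seteqP; split=> p //= _; exists 1 => //; apply: spec1.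
Qed.

Lemma zariski_openI : setI_closed zariski_open.
Proof.
move=> _ _ [E ->] [F ->]; exists [set h | exists2 f, E f & exists2 g, F g & h = f * g].
apply/seteqP; split=> p /=.
  move=> [[f Ef fp] [g Fg gp]]; exists (f * g); last exact: specMn.
  by exists f => //; exists g.
move=> [_ [f Ef [g Fg ->]]]; rewrite specM negb_or => /andP[fp gp].
by split; [exists f | exists g].
Qed.

Lemma zariski_open_bigU (I : Type) (f : I -> set (spec A)) :
  (forall i, zariski_open (f i)) -> zariski_open (\bigcup_i f i).
Proof.
move=> /choice[E fE]; exists (\bigcup_i E i); apply/seteqP; split=> p /=.
  by move=> [i _]; rewrite fE /= => -[a Ea ap]; exists a => //; exists i.
by move=> [a [i _ Ea] ap]; exists i => //; rewrite fE; exists a.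
Qed.

HB.instance Definition _ := isOpenTopological.Build (spec A)
  zariski_openT zariski_openI zariski_open_bigU.

Definition basic_open (f : A) : set (spec A) := [set p : spec A | f \notin p].

Lemma basic_open_open f : open (basic_open f).
Proof.
exists [set f]; apply/seteqP; split=> p /=; first by exists f.
by move=> [_ ->].
Qed.

End SpecTheory.

Section Localization.
Variables (A : comNzRingType) (p : spec A).

Definition ratio_at := {x : A * A | x.2 \notin p}.

Definition ratio_rel (x y : ratio_at) : bool :=
  `[< exists2 u, u \notin p &
        u * ((val x).1 * (val y).2 - (val y).1 * (val x).2) = 0 >].

Lemma ratio_refl : reflexive ratio_rel.
Proof. by move=> x; apply/asboolP; exists 1; rewrite ?spec1// subrr mulr0. Qed.

Lemma ratio_sym : symmetric ratio_rel.
Proof.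
move=> x y; apply/asboolP/asboolP => -[u up e]; exists u => //;
by apply/eqP; rewrite -oppr_eq0 -mulrN opprB e.
Qed.

Lemma ratio_trans : transitive ratio_rel.
Proof.
move=> [[b g] /= gp] [[a f] /= fp] [[c h] /= hp] /asboolP[/= u up e].
move=> /asboolP[/= v vp e']; apply/asboolP; exists (u * v * g) => /=.
  by do 2!apply: specMn => //.
transitivity (v * h * (u * (a * g - b * f)) + u * f * (v * (b * h - c * g))).
  by ring.
by rewrite e e' !mulr0 addr0.
Qed.

Canonical ratio_equiv := EquivRel ratio_rel ratio_refl ratio_sym ratio_trans.

Definition loc := {eq_quot ratio_rel}.

HB.instance Definition _ := EqQuotient.on loc.
HB.instance Definition _ := Choice.on loc.

Definition ratio (a f : A) (fp : f \notin p) : ratio_at :=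
  exist (fun x : A * A => x.2 \notin p) (a, f) fp.

Definition frac (a f : A) (fp : f \notin p) : loc := \pi_loc (ratio a fp).

Lemma frac_eq a f (fp : f \notin p) b g (gp : g \notin p) :
  frac a fp = frac b gp <-> exists2 u, u \notin p & u * (a * g - b * f) = 0.
Proof.
split=> [/eqP|h]; last by apply/eqP; rewrite eqmodE; apply/asboolP.
by rewrite eqmodE => /asboolP.
Qed.

Lemma fracP (x : loc) : exists a f (fp : f \notin p), x = frac a fp.
Proof.
elim/quotW: x => -[[a f] fp]; exists a, f, fp.
by [].
Qed.

Definition loc_add (x y : loc) : loc :=
  let a := val (repr x) in let b := val (repr y) in
  frac (a.1 * b.2 + b.1 * a.2) (specMn (valP (repr x)) (valP (repr y))).

Definition loc_mul (x y : loc) : loc :=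
  let a := val (repr x) in let b := val (repr y) in
  frac (a.1 * b.1) (specMn (valP (repr x)) (valP (repr y))).

Definition loc_opp (x : loc) : loc := frac (- (val (repr x)).1) (valP (repr x)).

Definition loc0 : loc := frac 0 (spec1 p).
Definition loc1 : loc := frac 1 (spec1 p).

Lemma frac_repr a f (fp : f \notin p) :
  exists2 u, u \notin p &
    u * ((val (repr (frac a fp))).1 * f - a * (val (repr (frac a fp))).2) = 0.
Proof.
apply/(frac_eq _ (valP (repr (frac a fp))) _ fp).
rewrite -[RHS]reprK /frac; congr (\pi_loc _).
by apply/val_inj => /=; case: (val _).
Qed.

Lemma loc_addE a f (fp : f \notin p) b g (gp : g \notin p) :
  loc_add (frac a fp) (frac b gp) = frac (a * g + b * f) (specMn fp gp).
Proof.
have [u up e] := frac_repr a fp; have [v vp e'] := frac_repr b gp.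
rewrite /loc_add; cbv zeta; move: (specMn (valP _) (valP _)) e e'.
case: (val (repr (frac a fp))) => a' f'.
case: (val (repr (frac b gp))) => b' g' /= ? e e'.
apply/frac_eq; exists (u * v); first exact: specMn.
transitivity (v * (g * g') * (u * (a' * f - a * f')) +
              u * (f * f') * (v * (b' * g - b * g'))); first by ring.
by rewrite e e' !mulr0 addr0.
Qed.

Lemma loc_mulE a f (fp : f \notin p) b g (gp : g \notin p) :
  loc_mul (frac a fp) (frac b gp) = frac (a * b) (specMn fp gp).
Proof.
have [u up e] := frac_repr a fp; have [v vp e'] := frac_repr b gp.
rewrite /loc_mul; cbv zeta; move: (specMn (valP _) (valP _)) e e'.
case: (val (repr (frac a fp))) => a' f'.
case: (val (repr (frac b gp))) => b' g' /= ? e e'.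
apply/frac_eq; exists (u * v); first exact: specMn.
transitivity (v * (b' * g) * (u * (a' * f - a * f')) +
              u * (a * f') * (v * (b' * g - b * g'))); first by ring.
by rewrite e e' !mulr0 addr0.
Qed.

Lemma loc_oppE a f (fp : f \notin p) : loc_opp (frac a fp) = frac (- a) fp.
Proof.
have [u up e] := frac_repr a fp.
rewrite /loc_opp; move: (valP (repr (frac a fp))) e.
case: (val (repr (frac a fp))) => a' f' /= ? e; apply/frac_eq; exists u => //.
transitivity (- (u * (a' * f - a * f'))); first by ring.
by rewrite e oppr0.
Qed.

Ltac loc_ax := apply/frac_eq; exists 1; [exact: spec1 | ring].

Lemma loc_addA : associative loc_add.
Proof.
move=> x y z; have [a [f [fp ->]]] := fracP x; have [b [g [gp ->]]] := fracP y.
by have [c [h [hp ->]]] := fracP z; rewrite !loc_addE; loc_ax.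
Qed.

Lemma loc_addC : commutative loc_add.
Proof.
move=> x y; have [a [f [fp ->]]] := fracP x; have [b [g [gp ->]]] := fracP y.
by rewrite !loc_addE; loc_ax.
Qed.

Lemma loc_add0 : left_id loc0 loc_add.
Proof.
by move=> x; have [a [f [fp ->]]] := fracP x; rewrite !loc_addE; loc_ax.
Qed.

Lemma loc_addN : left_inverse loc0 loc_opp loc_add.
Proof.
move=> x; have [a [f [fp ->]]] := fracP x; rewrite loc_oppE loc_addE.
by loc_ax.
Qed.

HB.instance Definition _ :=
  GRing.isZmodule.Build loc loc_addA loc_addC loc_add0 loc_addN.

Lemma loc_mulA : associative loc_mul.
Proof.
move=> x y z; have [a [f [fp ->]]] := fracP x; have [b [g [gp ->]]] := fracP y.
by have [c [h [hp ->]]] := fracP z; rewrite !loc_mulE; loc_ax.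
Qed.

Lemma loc_mulC : commutative loc_mul.
Proof.
move=> x y; have [a [f [fp ->]]] := fracP x; have [b [g [gp ->]]] := fracP y.
by rewrite !loc_mulE; loc_ax.
Qed.

Lemma loc_mul1 : left_id loc1 loc_mul.
Proof.
by move=> x; have [a [f [fp ->]]] := fracP x; rewrite !loc_mulE; loc_ax.
Qed.

Lemma loc_mulDl : left_distributive loc_mul loc_add.
Proof.
move=> x y z; have [a [f [fp ->]]] := fracP x; have [b [g [gp ->]]] := fracP y.
have [c [h [hp ->]]] := fracP z.
by rewrite !(loc_addE, loc_mulE) ; loc_ax.
Qed.

HB.instance Definition _ := GRing.Zmodule_isComPzRing.Build loc
  loc_mulA loc_mulC loc_mul1 loc_mulDl.

Lemma fracD a f (fp : f \notin p) b g (gp : g \notin p) :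
  frac a fp + frac b gp = frac (a * g + b * f) (specMn fp gp).
Proof. exact: loc_addE. Qed.

Lemma fracM a f (fp : f \notin p) b g (gp : g \notin p) :
  frac a fp * frac b gp = frac (a * b) (specMn fp gp).
Proof. exact: loc_mulE. Qed.

Lemma fracN a f (fp : f \notin p) : - frac a fp = frac (- a) fp.
Proof. exact: loc_oppE. Qed.

Lemma frac0 : 0 = frac 0 (spec1 p).
Proof. by []. Qed.

Lemma frac1 : 1 = frac 1 (spec1 p).
Proof. by []. Qed.

End Localization.

Section StructureSheaf.
Variable A : comNzRingType.

Definition locally_fraction (U : opens (spec A))
    (s : forall p : spec A, oset U p -> loc p) :=
  forall p : spec A, oset U p -> exists (W : opens (spec A)) (a f : A),
    [/\ oset W p, W `<=` U &
        forall (q : spec A) (Uq : oset U q), oset W q ->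
          exists fq : f \notin q, s q Uq = frac a fq].

Record spec_sec (U : opens (spec A)) := SpecSec {
  sval_at : forall p : spec A, oset U p -> loc p;
  spec_secP : locally_fraction sval_at
}.

HB.instance Definition _ U := gen_eqMixin (spec_sec U).
HB.instance Definition _ U := gen_choiceMixin (spec_sec U).

Lemma spec_sec_eq U (s t : spec_sec U) :
  (forall p (Up : oset U p), sval_at s Up = sval_at t Up) -> s = t.
Proof.
case: s t => [s sP] [t tP] /= e.
have {}e : s = t by apply: functional_extensionality_dep => p;
  apply: functional_extensionality_dep => Up; apply: e.
by case: _ / e in tP *; congr SpecSec; apply: Prop_irrelevance.
Qed.

Lemma sval_at_irr U (s : spec_sec U) p (h h' : oset U p) :
  sval_at s h = sval_at s h'.
Proof. by rewrite (Prop_irrelevance h h'). Qed.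

Section Operations.
Variable U : opens (spec A).
Implicit Types s t : spec_sec U.

Lemma cst_sec_subproof (a : A) :
  @locally_fraction U (fun p _ => frac a (spec1 p)).
Proof.
move=> p Up; exists U, a, 1; split=> // q Uq _.
by exists (spec1 q).
Qed.

Lemma add_sec_subproof s t :
  @locally_fraction U (fun p Up => sval_at s Up + sval_at t Up).
Proof.
move=> p Up; have [V [a [f [Vp VU sE]]]] := spec_secP s Up.
have [W [b [g [Wp WU tE]]]] := spec_secP t Up.
exists (opensI V W), (a * g + b * f), (f * g); split=> //.
  by move=> q [/VU].
move=> q Uq [Vq Wq]; have [fq ->] := sE q Uq Vq; have [gq ->] := tE q Uq Wq.
by exists (specMn fq gq); rewrite fracD.
Qed.

Lemma mul_sec_subproof s t :
  @locally_fraction U (fun p Up => sval_at s Up * sval_at t Up).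
Proof.
move=> p Up; have [V [a [f [Vp VU sE]]]] := spec_secP s Up.
have [W [b [g [Wp WU tE]]]] := spec_secP t Up.
exists (opensI V W), (a * b), (f * g); split=> //.
  by move=> q [/VU].
move=> q Uq [Vq Wq]; have [fq ->] := sE q Uq Vq; have [gq ->] := tE q Uq Wq.
by exists (specMn fq gq); rewrite fracM.
Qed.

Lemma opp_sec_subproof s : @locally_fraction U (fun p Up => - sval_at s Up).
Proof.
move=> p Up; have [V [a [f [Vp VU sE]]]] := spec_secP s Up.
exists V, (- a), f; split=> // q Uq Vq; have [fq ->] := sE q Uq Vq.
by exists fq; rewrite fracN.
Qed.

Definition cst_sec a : spec_sec U := SpecSec (cst_sec_subproof a).
Definition add_sec s t : spec_sec U := SpecSec (add_sec_subproof s t).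
Definition mul_sec s t : spec_sec U := SpecSec (mul_sec_subproof s t).
Definition opp_sec s : spec_sec U := SpecSec (opp_sec_subproof s).

Lemma add_secA : associative add_sec.
Proof. by move=> s t u; apply: spec_sec_eq => p Up /=; rewrite addrA. Qed.
Lemma add_secC : commutative add_sec.
Proof. by move=> s t; apply: spec_sec_eq => p Up /=; rewrite addrC. Qed.
Lemma add_sec0 : left_id (cst_sec 0) add_sec.
Proof. by move=> s; apply: spec_sec_eq => p Up /=; rewrite -frac0 add0r. Qed.
Lemma add_secN : left_inverse (cst_sec 0) opp_sec add_sec.
Proof. by move=> s; apply: spec_sec_eq => p Up /=; rewrite addNr. Qed.

HB.instance Definition _ :=
  GRing.isZmodule.Build (spec_sec U) add_secA add_secC add_sec0 add_secN.

Lemma mul_secA : associative mul_sec.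
Proof. by move=> s t u; apply: spec_sec_eq => p Up /=; rewrite mulrA. Qed.
Lemma mul_secC : commutative mul_sec.
Proof. by move=> s t; apply: spec_sec_eq => p Up /=; rewrite mulrC. Qed.
Lemma mul_sec1 : left_id (cst_sec 1) mul_sec.
Proof. by move=> s; apply: spec_sec_eq => p Up /=; rewrite -frac1 mul1r. Qed.
Lemma mul_secDl : left_distributive mul_sec add_sec.
Proof. by move=> s t u; apply: spec_sec_eq => p Up /=; rewrite mulrDl. Qed.

HB.instance Definition _ := GRing.Zmodule_isComPzRing.Build (spec_sec U)
  mul_secA mul_secC mul_sec1 mul_secDl.

End Operations.

Section Restriction.
Variables (U V : opens (spec A)) (h : V `<=` U).

Lemma res_sec_subproof (s : spec_sec U) :
  @locally_fraction V (fun p Vp => sval_at s (h Vp)).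
Proof.
move=> p Vp; have [W [a [f [Wp WU sE]]]] := spec_secP s (h Vp).
exists (opensI V W), a, f; split=> //; first by move=> q [].
by move=> q Vq [_ Wq]; apply: sE.
Qed.

Definition res_sec (s : spec_sec U) : spec_sec V :=
  SpecSec (res_sec_subproof s).

Lemma res_sec_is_zmod_morphism : zmod_morphism res_sec.
Proof. by move=> s t; apply: spec_sec_eq. Qed.

Lemma res_sec_is_monoid_morphism : monoid_morphism res_sec.
Proof. by split=> [|s t]; apply: spec_sec_eq. Qed.

HB.instance Definition _ := GRing.isZmodMorphism.Build
  (spec_sec U) (spec_sec V) res_sec res_sec_is_zmod_morphism.
HB.instance Definition _ := GRing.isMonoidMorphism.Build
  (spec_sec U) (spec_sec V) res_sec res_sec_is_monoid_morphism.

End Restriction.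

Lemma res_sec_glue (I : Type) (U : opens (spec A)) (F : I -> opens (spec A))
    (hF : forall i, F i `<=` U) (s : forall i, spec_sec (F i)) :
  U `<=` \bigcup_i F i ->
  (forall i j (W : opens (spec A)) (hi : W `<=` F i) (hj : W `<=` F j),
     res_sec hi (s i) = res_sec hj (s j)) ->
  exists! t : spec_sec U, forall i, res_sec (hF i) t = s i.
Proof.
move=> cov cmp.
have ex p (Up : oset U p) : exists i, oset (F i) p.
  by have [i _ Fi] := cov p Up; exists i.
pose t p (Up : oset U p) : loc p := sval_at (s (sval (cid (ex p Up)))) (svalP (cid (ex p Up))).
have tE p (Up : oset U p) i (Fi : oset (F i) p) : t p Up = sval_at (s i) Fi.
  rewrite /t; case: (cid _) => j /= Fj.
  have hi : opensI (F i) (F j) `<=` F i by move=> q [].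
  have hj : opensI (F i) (F j) `<=` F j by move=> q [].
  have Wp : oset (opensI (F i) (F j)) p by split.
  have := congr1 (fun r => sval_at r Wp) (cmp i j _ hi hj) => /= e.
  by rewrite (sval_at_irr (s i) Fi (hi p Wp)) e; apply: sval_at_irr.
have tP : locally_fraction t.
  move=> p Up; have [i Fi] := ex p Up.
  have [W [a [f [Wp WF sE]]]] := spec_secP (s i) Fi.
  exists W, a, f; split=> //; first by move=> q /WF /hF.
  by move=> q Uq Wq; rewrite (tE q Uq i (WF q Wq)); apply: sE.
exists (SpecSec tP); split=> [i|t' t'E].
  by apply: spec_sec_eq => p Fp /=; apply: tE.
apply: spec_sec_eq => p Up /=; have [i Fi] := ex p Up.
rewrite (tE p Up i Fi) -(t'E i) /=.
exact: sval_at_irr.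
Qed.

Lemma res_sec_id (U : opens (spec A)) (h : U `<=` U) (s : spec_sec U) :
  res_sec h s = s.
Proof.
by apply: spec_sec_eq => p Up; exact: (sval_at_irr s).
Qed.

Lemma res_sec_comp (U V W : opens (spec A)) (hVU : V `<=` U) (hWV : W `<=` V)
    (hWU : W `<=` U) (s : spec_sec U) :
  res_sec hWV (res_sec hVU s) = res_sec hWU s.
Proof.
by apply: spec_sec_eq => p Up; exact: (sval_at_irr s).
Qed.

Definition Spec : ringed_space := {|
  rs_top := spec A;
  sec := fun U => spec_sec U;
  res := fun U V h => res_sec h;
  res_id := res_sec_id;
  res_comp := res_sec_comp;
  sec_glue := res_sec_glue |}.

End StructureSheaf.

Section SpecMap.
Variables (A B : comNzRingType) (phi : {rmorphism A -> B}).

Lemma comap_idealr (q : spec B) : idealr_closed (fun a : A => phi a \in q).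
Proof.
case: (spec_idealr q) => q0 q1 qL; split; rewrite ?inE.
- by rewrite -topredE /= rmorph0.
- by rewrite -topredE /= rmorph1.
by move=> a u v uq vq; rewrite -topredE /= rmorphD rmorphM; apply: qL.
Qed.

Lemma comap_prime (q : spec B) : prime_idealr_closed (fun a : A => phi a \in q).
Proof.
by move=> u v; rewrite -!topredE /= rmorphM specM.
Qed.

Definition comap (q : spec B) : spec A :=
  SpecPoint (comap_idealr q) (@comap_prime q).

Lemma in_comap (q : spec B) a : (a \in comap q) = (phi a \in q).
Proof. by []. Qed.

Lemma notin_comap (q : spec B) a : a \notin comap q -> phi a \notin q.
Proof. by []. Qed.

Lemma comap_continuous : continuous comap.
Proof.
apply/continuousP => _ [E ->]; exists (phi @` E); apply/seteqP; split=> q /=.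
  by move=> [f Ef fq]; exists (phi f) => //; exists f.
by move=> [_ [f Ef <-] fq]; exists f.
Qed.

Section LocMap.
Variable q : spec B.

Definition loc_map (x : loc (comap q)) : loc q :=
  frac (phi (val (repr x)).1) (notin_comap (valP (repr x))).

Lemma loc_mapE a f (fq : f \notin comap q) :
  loc_map (frac a fq) = frac (phi a) (notin_comap fq).
Proof.
have [u up e] := frac_repr a fq.
rewrite /loc_map; apply/frac_eq; exists (phi u); first exact: notin_comap.
by rewrite -!rmorphM -rmorphB -rmorphM e rmorph0.
Qed.

Lemma loc_map_is_zmod_morphism : zmod_morphism loc_map.
Proof.
move=> x y; have [a [f [fp ->]]] := fracP x; have [b [g [gp ->]]] := fracP y.
rewrite fracN fracD !loc_mapE fracN fracD.
apply/frac_eq; exists 1; first exact: spec1.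
by rewrite !rmorphD !rmorphM rmorphN; ring.
Qed.

Lemma loc_map_is_monoid_morphism : monoid_morphism loc_map.
Proof.
split=> [|x y].
  rewrite frac1 loc_mapE frac1; apply/frac_eq; exists 1; first exact: spec1.
  by rewrite rmorph1; ring.
have [a [f [fp ->]]] := fracP x; have [b [g [gp ->]]] := fracP y.
rewrite fracM !loc_mapE fracM.
apply/frac_eq; exists 1; first exact: spec1.
by rewrite !rmorphM; ring.
Qed.

HB.instance Definition _ := GRing.isZmodMorphism.Build
  (loc (comap q)) (loc q) loc_map loc_map_is_zmod_morphism.
HB.instance Definition _ := GRing.isMonoidMorphism.Build
  (loc (comap q)) (loc q) loc_map loc_map_is_monoid_morphism.

End LocMap.

Section Pull.
Variable V : opens (Spec A).
Let preV : opens (Spec B) := preim comap_continuous V.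

Lemma pull_sec_subproof (s : spec_sec V) :
  @locally_fraction B preV (fun q Vq => loc_map (sval_at s (Vq : oset V (comap q)))).
Proof.
move=> q Vq; have [W [a [f [Wp WV sE]]]] := spec_secP s Vq.
exists (preim comap_continuous W), (phi a), (phi f); split=> //.
  by move=> r /WV.
move=> r Vr Wr; have [fr ->] := sE (comap r) Vr Wr.
by exists (notin_comap fr); rewrite loc_mapE.
Qed.

Definition pull_sec (s : spec_sec V) : spec_sec preV :=
  SpecSec (pull_sec_subproof s).

Lemma pull_sec_is_zmod_morphism : zmod_morphism pull_sec.
Proof. by move=> s t; apply: spec_sec_eq => q Vq /=; rewrite !raddfB. Qed.

Lemma pull_sec_is_monoid_morphism : monoid_morphism pull_sec.
Proof.
split=> [|s t]; apply: spec_sec_eq => q Vq /=; last by rewrite rmorphM.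
by rewrite -!frac1 rmorph1.
Qed.

HB.instance Definition _ := GRing.isZmodMorphism.Build
  (spec_sec V) (spec_sec preV) pull_sec pull_sec_is_zmod_morphism.
HB.instance Definition _ := GRing.isMonoidMorphism.Build
  (spec_sec V) (spec_sec preV) pull_sec pull_sec_is_monoid_morphism.

End Pull.

Lemma pull_sec_res (V W : opens (Spec A)) (h : W `<=` V)
    (h' : preim comap_continuous W `<=` preim comap_continuous V)
    (s : spec_sec V) :
  res_sec h' (pull_sec s) = pull_sec (res_sec h s).
Proof.
apply: spec_sec_eq => q Wq /=; congr loc_map.
exact: sval_at_irr.
Qed.

Lemma pull_sec_local (V : opens (Spec A)) (s : @sec (Spec A) V) (q : Spec B) :
  oset V (comap q) ->
  @germ_unit (Spec B) _ (pull_sec s) q -> @germ_unit (Spec A) V s (comap q).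
Proof.
move=> Vq [W [h [t [Wq /(congr1 (fun r => sval_at r Wq)) /=]]]].
have [N [a [f [Np NV sE]]]] := spec_secP s (h q Wq).
have [fp ->] := sE (comap q) (h q Wq) Np.
have [b [g [gq ->]]] := fracP (sval_at t Wq).
rewrite loc_mapE fracM => /frac_eq[u uq].
rewrite mulr1 mul1r => e.
have ap : a \notin comap q.
  apply/negP => aq; suff : u * (phi f * g) \in q.
    by apply/negP; apply: specMn => //; apply: specMn.
  have -> : u * (phi f * g) = u * b * phi a - u * (phi a * b - phi f * g).
    by ring.
  by rewrite e subr0; apply: specMl.
pose D := Opens (basic_open_open a); pose M := opensI N D.
have hM : M `<=` V by move=> r [/NV].
have iP : @locally_fraction A M (fun r Mr => frac f (Mr.2 : a \notin r)).
  by move=> r Mr; exists M, f, a; split=> // r' Mr' _; exists Mr'.2.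
exists M, hM, (SpecSec iP); split; first by split.
apply: spec_sec_eq => r Mr /=; have [fr ->] := sE r (hM r Mr) Mr.1.
rewrite fracM; apply/frac_eq; exists 1; first exact: spec1.
by ring.
Qed.

Definition Spec_map : morphism (Spec B) (Spec A) :=
  @Morphism (Spec B) (Spec A) comap comap_continuous (fun V => @pull_sec V)
    pull_sec_res pull_sec_local.

End SpecMap.

(* Spec 0 is empty, so nonzero rings suffice as local models. *)
Definition is_scheme (X : ringed_space) :=
  forall x : X, exists (A : comNzRingType) (j : morphism (Spec A) X),
    open_immersion j /\ range j x.

Lemma Spec_is_scheme (A : comNzRingType) : is_scheme (Spec A).
Proof.
move=> x; exists A, (morphism_id (Spec A)); split; last by exists x.
split=> [//|W oW|V _]; last exact: id_pull_bij.
by rewrite (_ : _ @` W = W) // image_id.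
Qed.

Definition irreducible_space (X : topologicalType) :=
  [set: X] !=set0 /\
  forall F G : set X, closed F -> closed G -> F `|` G = setT ->
    F = setT \/ G = setT.

Section Tensor.
Variables (R : comNzRingType) (M N : lmodType R).

(* Generators and relations: a sequence stands for the sum of the x (x) y over
   its entries (x, y). *)
Inductive tensor_rel : seq (M * N) -> seq (M * N) -> Prop :=
| tensor_rel_refl s : tensor_rel s s
| tensor_rel_sym s t : tensor_rel s t -> tensor_rel t s
| tensor_rel_trans s t u : tensor_rel s t -> tensor_rel t u -> tensor_rel s u
| tensor_rel_cat s s' t t' :
    tensor_rel s s' -> tensor_rel t t' -> tensor_rel (s ++ t) (s' ++ t')
| tensor_rel_swap s t : tensor_rel (s ++ t) (t ++ s)
| tensor_rel_0 y : tensor_rel [:: (0, y)] [::]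
| tensor_rel_addl x x' y : tensor_rel [:: (x + x', y)] [:: (x, y); (x', y)]
| tensor_rel_addr x y y' : tensor_rel [:: (x, y + y')] [:: (x, y); (x, y')]
| tensor_rel_scale a x y : tensor_rel [:: (a *: x, y)] [:: (x, a *: y)].

Definition tensor_relb s t : bool := `[< tensor_rel s t >].

Lemma tensor_relb_refl : reflexive tensor_relb.
Proof. by move=> s; apply/asboolP; apply: tensor_rel_refl. Qed.
Lemma tensor_relb_sym : symmetric tensor_relb.
Proof. by move=> s t; apply/asboolP/asboolP; apply: tensor_rel_sym. Qed.
Lemma tensor_relb_trans : transitive tensor_relb.
Proof.
move=> t s u /asboolP st /asboolP tu; apply/asboolP.
exact: tensor_rel_trans st tu.
Qed.

Canonical tensor_equiv :=
  EquivRel tensor_relb tensor_relb_refl tensor_relb_sym tensor_relb_trans.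

Definition tensor := {eq_quot tensor_relb}.

HB.instance Definition _ := EqQuotient.on tensor.
HB.instance Definition _ := Choice.on tensor.

Definition tsum (s : seq (M * N)) : tensor := \pi_tensor s.

Definition pure (x : M) (y : N) : tensor := tsum [:: (x, y)].

Lemma tsum_eq s t : tsum s = tsum t <-> tensor_rel s t.
Proof.
split=> [/eqP|h]; first by rewrite eqmodE => /asboolP.
by apply/eqP; rewrite eqmodE; apply/asboolP.
Qed.

Lemma tsumP (z : tensor) : exists s, z = tsum s.
Proof. by exists (repr z); rewrite /tsum reprK. Qed.

Lemma tsum_repr s : tensor_rel (repr (tsum s)) s.
Proof. by apply/tsum_eq; rewrite /tsum reprK. Qed.

Definition scale_seq (a : R) (s : seq (M * N)) : seq (M * N) :=
  [seq (a *: z.1, z.2) | z <- s].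

Lemma scale_seq_rel a s t :
  tensor_rel s t -> tensor_rel (scale_seq a s) (scale_seq a t).
Proof.
elim=> {s t} /=.
- by move=> s; apply: tensor_rel_refl.
- by move=> s t _; apply: tensor_rel_sym.
- by move=> s t u _ st _; apply: tensor_rel_trans st.
- by move=> s s' t t' _ hs _ ht; rewrite /scale_seq !map_cat; apply: tensor_rel_cat.
- by move=> s t; rewrite /scale_seq !map_cat; apply: tensor_rel_swap.
- by move=> y; rewrite scaler0; apply: tensor_rel_0.
- by move=> x x' y; rewrite scalerDr; apply: tensor_rel_addl.
- by move=> x y y'; apply: tensor_rel_addr.
by move=> b x y; rewrite scalerA mulrC -scalerA; apply: tensor_rel_scale.
Qed.

Definition tensor_add (z w : tensor) : tensor := tsum (repr z ++ repr w).
Definition tensor_scale (a : R) (z : tensor) : tensor :=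
  tsum (scale_seq a (repr z)).
Definition tensor_opp (z : tensor) : tensor := tensor_scale (- 1) z.

Lemma tensor_addE s t : tensor_add (tsum s) (tsum t) = tsum (s ++ t).
Proof. by apply/tsum_eq/tensor_rel_cat; apply: tsum_repr. Qed.

Lemma tensor_scaleE a s : tensor_scale a (tsum s) = tsum (scale_seq a s).
Proof. by apply/tsum_eq/scale_seq_rel/tsum_repr. Qed.

Lemma tensor_addA : associative tensor_add.
Proof.
move=> u v w; have [r ->] := tsumP u; have [s ->] := tsumP v.
by have [t ->] := tsumP w; rewrite !tensor_addE catA.
Qed.

Lemma tensor_addC : commutative tensor_add.
Proof.
move=> u v; have [r ->] := tsumP u; have [s ->] := tsumP v.
by rewrite !tensor_addE; apply/tsum_eq/tensor_rel_swap.
Qed.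

Lemma tensor_add0 : left_id (tsum [::]) tensor_add.
Proof. by move=> u; have [r ->] := tsumP u; rewrite tensor_addE. Qed.

Lemma tensor_scaleDr a (z w : tensor) :
  tensor_scale a (tensor_add z w) =
  tensor_add (tensor_scale a z) (tensor_scale a w).
Proof.
have [r ->] := tsumP z; have [s ->] := tsumP w.
by rewrite !(tensor_addE, tensor_scaleE) /scale_seq map_cat.
Qed.

Lemma tensor_scaleDl (z : tensor) a b :
  tensor_scale (a + b) z = tensor_add (tensor_scale a z) (tensor_scale b z).
Proof.
have [s ->] := tsumP z; rewrite !tensor_scaleE.
elim: s => [|[x y] s IH] /=; first by rewrite tensor_addE.
rewrite -!(cat1s _ (scale_seq _ _)) -!tensor_addE IH.
have -> : tsum [:: ((a + b) *: x, y)] =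
          tensor_add (tsum [:: (a *: x, y)]) (tsum [:: (b *: x, y)]).
  by rewrite tensor_addE scalerDl; apply/tsum_eq/tensor_rel_addl.
rewrite -!tensor_addA; congr tensor_add.
by rewrite tensor_addA (tensor_addC (tsum [:: (b *: x, y)])) -tensor_addA.
Qed.

Lemma tensor_scale0 (z : tensor) : tensor_scale 0 z = tsum [::].
Proof.
have [s ->] := tsumP z; rewrite tensor_scaleE.
elim: s => [//|[x y] s IH] /=; rewrite -cat1s -tensor_addE IH scale0r.
rewrite tensor_addC tensor_add0; exact/tsum_eq/tensor_rel_0.
Qed.

Lemma tensor_scale1 : left_id 1 tensor_scale.
Proof.
move=> z; have [s ->] := tsumP z; rewrite tensor_scaleE; congr tsum.
by rewrite /scale_seq -[RHS]map_id; apply: eq_map => -[x y] /=; rewrite scale1r.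
Qed.

Lemma tensor_scaleA a b (z : tensor) :
  tensor_scale a (tensor_scale b z) = tensor_scale (a * b) z.
Proof.
have [s ->] := tsumP z; rewrite !tensor_scaleE; congr tsum.
by rewrite /scale_seq -map_comp; apply: eq_map => w /=; rewrite scalerA.
Qed.

Lemma tensor_addN : left_inverse (tsum [::]) tensor_opp tensor_add.
Proof.
move=> z; rewrite /tensor_opp -{2}[z]tensor_scale1 -tensor_scaleDl.
by rewrite addNr tensor_scale0.
Qed.

HB.instance Definition _ := GRing.isZmodule.Build tensor
  tensor_addA tensor_addC tensor_add0 tensor_addN.
HB.instance Definition _ := GRing.Zmodule_isLmodule.Build R tensor
  tensor_scaleA tensor_scale1 tensor_scaleDr tensor_scaleDl.

Lemma tsum_nil : tsum [::] = 0.
Proof. by []. Qed.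

Lemma tsum_cons z s : tsum (z :: s) = pure z.1 z.2 + tsum s.
Proof. by case: z => x y; exact: (esym (tensor_addE [:: (x, y)] s)). Qed.

Lemma tsumE s : tsum s = \sum_(z <- s) pure z.1 z.2.
Proof.
by elim: s => [|z s IH]; rewrite ?big_nil ?tsum_nil// big_cons tsum_cons IH.
Qed.

Lemma pureDl x x' y : pure (x + x') y = pure x y + pure x' y.
Proof.
by rewrite -[RHS]/(tensor_add _ _) tensor_addE; apply/tsum_eq/tensor_rel_addl.
Qed.

Lemma pureDr x y y' : pure x (y + y') = pure x y + pure x y'.
Proof.
by rewrite -[RHS]/(tensor_add _ _) tensor_addE; apply/tsum_eq/tensor_rel_addr.
Qed.

Lemma pureZl a x y : pure (a *: x) y = a *: pure x y.
Proof. by rewrite -[RHS]/(tensor_scale _ _) tensor_scaleE. Qed.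

Lemma pureZr a x y : pure x (a *: y) = a *: pure x y.
Proof. by rewrite -pureZl; apply/esym/tsum_eq/tensor_rel_scale. Qed.

Section Universal.
Variables (P : lmodType R) (b : M -> N -> P).
Hypotheses (bDl : forall x x' y, b (x + x') y = b x y + b x' y)
  (bDr : forall x y y', b x (y + y') = b x y + b x y')
  (bZl : forall a x y, b (a *: x) y = a *: b x y)
  (bZr : forall a x y, b x (a *: y) = a *: b x y).

Definition tensor_lift (z : tensor) : P := \sum_(w <- repr z) b w.1 w.2.

Lemma tensor_lift_tsum s : tensor_lift (tsum s) = \sum_(w <- s) b w.1 w.2.
Proof.
rewrite /tensor_lift; move: (tsum_repr s); move: (repr _) => t.
elim=> //=.
- by move=> {}s {}t u _ -> _ ->.
- by move=> r r' u u' _ e _ e'; rewrite !big_cat /= e e'.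
- by move=> r u; rewrite !big_cat /= addrC.
- by move=> y; rewrite big_seq1 big_nil /= -(scale0r 0) bZl scale0r.
- by move=> x x' y; rewrite !big_cons !big_nil /= !addr0.
- by move=> x y y'; rewrite !big_cons !big_nil /= !addr0.
by move=> a x y; rewrite !big_seq1 /= bZl bZr.
Qed.

Lemma tensor_lift_is_linear : linear tensor_lift.
Proof.
move=> a z w; have [s ->] := tsumP z; have [t ->] := tsumP w.
rewrite -[a *: _]/(tensor_scale a _) tensor_scaleE -[_ + _]/(tensor_add _ _).
rewrite tensor_addE !tensor_lift_tsum big_cat /= scaler_sumr big_map /=.
by congr (_ + _); apply: eq_bigr => u _; rewrite bZl.
Qed.

Lemma tensor_universal : exists l : {linear tensor -> P},
  (forall x y, l (pure x y) = b x y) /\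
  forall l' : {linear tensor -> P}, (forall x y, l' (pure x y) = b x y) ->
    l' =1 l.
Proof.
pose lin := GRing.isLinear.Build R tensor P *:%R tensor_lift
  tensor_lift_is_linear.
pose l : {linear tensor -> P} := HB.pack tensor_lift lin.
exists l; split=> [x y|l' l'E z].
  by rewrite /= tensor_lift_tsum big_seq1.
have [s ->] := tsumP z; rewrite /= tensor_lift_tsum tsumE linear_sum.
by apply: eq_bigr => w _; rewrite l'E.
Qed.

End Universal.

End Tensor.

Definition tensor_map (R : comNzRingType) (M N M' N' : lmodType R)
    (f : M -> M') (g : N -> N') (z : tensor M N) : tensor M' N' :=
  tensor_lift (fun x y => pure (f x) (g y)) z.

Lemma tensor_map_pure (R : comNzRingType) (M N M' N' : lmodType R)
    (f : {linear M -> M'}) (g : {linear N -> N'}) (x : M) (y : N) :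
  tensor_map f g (pure x y) = pure (f x) (g y).
Proof.
rewrite /tensor_map tensor_lift_tsum ?big_seq1 //=.
- by move=> u u' v; rewrite linearD pureDl.
- by move=> u v v'; rewrite linearD pureDr.
- by move=> a u v; rewrite linearZ pureZl.
by move=> a u v; rewrite linearZ pureZr.
Qed.

(* The semilinear map h : M -> M' exhibits M' as the extension of scalars of M
   along phi : R -> R'. *)
Definition is_scalar_extension (R R' : comNzRingType) (phi : {rmorphism R -> R'})
    (M : lmodType R) (M' : lmodType R') (h : {linear M -> M' | phi \; *:%R}) :=
  forall (N : lmodType R') (g : {linear M -> N | phi \; *:%R}),
    exists l : {linear M' -> N}, (forall m, l (h m) = g m) /\
      forall l' : {linear M' -> N}, (forall m, l' (h m) = g m) -> l' =1 l.

Section Bilin.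
Variables (n d r1 r2 : nat).

Section OverRing.
Variable A : comNzRingType.
Local Notation S := {mpoly A[n]}.

(* M_f is free over A_f with basis the e i / 1; scaling by powers of f, every
   basis of M_f can be taken of this form. A acts on M through A -> S_A. *)
Definition basis_away (M : lmodType S) (f : A) (e : 'I_d -> M) :=
  (forall m : M, exists (N : nat) (a : 'I_d -> A),
     (f ^+ N)%:MP *: m = \sum_i (a i)%:MP *: e i) /\
  (forall a : 'I_d -> A, \sum_i (a i)%:MP *: e i = 0 ->
     exists N : nat, forall i, f ^+ N * a i = 0).

Definition locally_free_rank (M : lmodType S) :=
  forall p : spec A, exists2 f : A, f \notin p &
    exists e : 'I_d -> M, basis_away f e.

Record bilin_triple := BilinTriple {
  bM1 : lmodType S;
  bM2 : lmodType S;
  bM3 : lmodType S;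
  bp1 : {linear 'rV[S]_r1 -> bM1};
  bp2 : {linear 'rV[S]_r2 -> bM2};
  bpi : {linear tensor bM1 bM2 -> bM3};
  bp1_surj : forall m, exists v, bp1 v = m;
  bp2_surj : forall m, exists v, bp2 v = m;
  bpi_surj : forall m, exists z, bpi z = m;
  bM1_free : locally_free_rank bM1;
  bM2_free : locally_free_rank bM2;
  bM3_free : locally_free_rank bM3
}.

(* The surjections have equal kernels. When p1, p2 have the same kernels as
   p1', p2', the domains of pi and pi' are the same quotient of
   S_A^r1 (x) S_A^r2, where their kernels can be compared. *)
Definition bilin_eq (D D' : bilin_triple) :=
  [/\ forall v, bp1 D v = 0 <-> bp1 D' v = 0,
      forall v, bp2 D v = 0 <-> bp2 D' v = 0 &
      forall z : tensor 'rV[S]_r1 'rV[S]_r2,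
        bpi D (tensor_map (bp1 D) (bp2 D) z) = 0 <->
        bpi D' (tensor_map (bp1 D') (bp2 D') z) = 0].

End OverRing.

(* D' is the pull-back of D along Spec B -> Spec A; M (x)_A B is the extension
   of scalars of the S_A-module M to S_B. *)
Definition bilin_pullback (A B : comNzRingType) (phi : {rmorphism A -> B})
    (D : bilin_triple A) (D' : bilin_triple B) :=
  let phiS : {rmorphism {mpoly A[n]} -> {mpoly B[n]}} := map_mpoly phi in
  exists (h1 : {linear bM1 D -> bM1 D' | phiS \; *:%R})
         (h2 : {linear bM2 D -> bM2 D' | phiS \; *:%R})
         (h3 : {linear bM3 D -> bM3 D' | phiS \; *:%R}),
    [/\ is_scalar_extension h1, is_scalar_extension h2 & is_scalar_extension h3]
    /\
    [/\ forall v, h1 (bp1 D v) = bp1 D' (map_mx phiS v),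
        forall v, h2 (bp2 D v) = bp2 D' (map_mx phiS v) &
        forall x y, h3 (bpi D (pure x y)) = bpi D' (pure (h1 x) (h2 y))].

(* Morphisms of k-schemes Spec A -> X, for the k-scheme sX : X -> Spec k. *)
Record kmorphism (k : comNzRingType) (X : ringed_space)
    (sX : morphism X (Spec k)) (A : comAlgType k) := KMorphism {
  kmor :> morphism (Spec A) X;
  kmor_over : morphism_eq (morphism_comp sX kmor)
                (Spec_map (in_alg A : {rmorphism k -> A}))
}.

(* A k-scheme is determined by its functor of points on affine k-schemes. For
   A = 0, which comAlgType excludes, both sides would be singletons. *)
Definition represents_Bilin (k : comNzRingType) (X : ringed_space)
    (sX : morphism X (Spec k)) :=
  exists eta : forall A : comAlgType k, kmorphism sX A -> bilin_triple A,
  [/\ forall (A : comAlgType k) (f g : kmorphism sX A),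
        morphism_eq f g <-> bilin_eq (eta A f) (eta A g),
      forall (A : comAlgType k) (D : bilin_triple A),
        exists f : kmorphism sX A, bilin_eq (eta A f) D &
      forall (A B : comAlgType k) (phi : {lrmorphism A -> B})
          (f : kmorphism sX A) (g : kmorphism sX B),
        morphism_eq g (morphism_comp f (Spec_map phi)) ->
        bilin_pullback phi (eta A f) (eta B g)].

End Bilin.

(* Main.v *)
Require Import Defs.
From mathcomp.multinomials Require Import mpoly.
From HB Require Import structures.
From mathcomp Require Import all_boot all_order all_algebra ring.
From mathcomp Require Import boolp classical_sets topology.

(** Let [e_i], [f_j] be the images in [M_1], [M_2] of the standard generators,
and let [x . y] be the image of [x (x) y] in [M_3]. Two nonempty open
conditions on a point of Bilin turn out to exclude each other.

- (cyclic) [e_0] generates [M_1] as an [S]-module.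
- (noncommuting) The products [e_0 . f_j], for [j < d], form a basis of [M_3];
  so there are matrices [T_1], [T_2] expressing [e_1 . f_j] and [e_2 . f_j] in
  this basis, and these matrices do not commute.

If the first one holds, then [e_a = s_a e_0] with [s_a] in [S], hence
[e_a . f_j = s_a (e_0 . f_j)], and [T_a] is the matrix of multiplication by
[s_a] on [M_3]. As [S] is commutative, [T_1] and [T_2] commute, against the
second condition ([cyclic_commute]). Both conditions hold somewhere:
for the first take [k^d] with coordinatewise product and a variable of [S]
acting with distinct eigenvalues ([cyclic_triple]); for the second let [S] act
through evaluation at the origin, so that every bilinear map
[k^d x k^d -> k^d] is allowed, with any [T_1] and [T_2] ([matrix_triple]).
This second choice needs three generators, whence [d >= 3].

Openness is used in the following form. Suppose that the scheme [X] is
irreducible; then it has a generic point [eta], which is a generization of the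
two [k]-points [P] and [Q] given by the examples. Restrict the universal family
to the local ring [B] of [X] at [P]. There the modules are free, and by
Nakayama's lemma ([nakayama]) [e_0] generates [M_1] over [B], because it does
so at the closed point; by pull-back it does so over the local ring of [X] at
[eta]. In the same way the second condition passes from [Q] to [eta], since an
entry of the commutator of [T_1] and [T_2] is a unit at [Q]. So both hold over
one nonzero ring, which is absurd.

To move between the functor of points and the topology of [X], it is enough to
know the morphism from the spectrum of the local ring at a point to [X], and
that every morphism from the spectrum of a local ring, whose closed point goes
to a generization of this point, factors through it ([stalk_model]). *)

Set Implicit Arguments.
Unset Strict Implicit.
Unset Printing Implicit Defensive.

Import GRing.Theory.
Local Open Scope classical_set_scope.
Local Open Scope ring_scope.

Local Notation pre f V := (Defs.preim (@mcont _ _ f) V).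

(** * Morphisms of ringed spaces *)

Section MorphismEq.

Lemma morphism_eq_sym (X Y : ringed_space) (f g : morphism X Y) :
  morphism_eq f g -> morphism_eq g f.
Proof. by move=> [e1 e2]; split=> // V s W hf hg; rewrite (e2 V s W hg hf). Qed.

Lemma morphism_eq_trans (X Y : ringed_space) (g f h : morphism X Y) :
  morphism_eq f g -> morphism_eq g h -> morphism_eq f h.
Proof.
move=> [e1 e2] [e3 e4]; split=> [x|V s W hf hh]; first by rewrite e1.
have hg : W `<=` pre g V by move=> x /hf; rewrite /= e1.
by rewrite (e2 V s W hf hg).
Qed.

(** Equality of morphisms compares restrictions of pull-backs to open sets that
are only propositionally equal; this rule lets one shrink the open set of the
target before pulling back. *)
Lemma res_mpull (X Y : ringed_space) (f : morphism X Y) (V V' : opens Y)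
    (h : V' `<=` V) (s : sec V) (W : opens X) (hW : W `<=` pre f V)
    (hW' : W `<=` pre f V') :
  res hW' (mpull f V' (res h s)) = res hW (mpull f V s).
Proof.
have h' : pre f V' `<=` pre f V by move=> x /h.
by rewrite -(mpull_res h h') (res_comp _ _ hW).
Qed.

Lemma morphism_compA (X Y Z T : ringed_space) (f : morphism Z T)
    (g : morphism Y Z) (h : morphism X Y) :
  morphism_eq (morphism_comp f (morphism_comp g h))
              (morphism_comp (morphism_comp f g) h).
Proof.
split=> // V s W hf hg; rewrite /=.
rewrite (res_comp _ _ (hf : W `<=` pre (morphism_comp g h) (pre f V))).
rewrite (res_comp _ _ (hf : W `<=` pre h (pre g (pre f V)))).
rewrite (res_comp _ _ (hf : W `<=` pre h (pre (morphism_comp f g) V))).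
by symmetry; apply: res_mpull.
Qed.

Lemma morphism_comp_congr (X Y Z : ringed_space) (e : morphism Y Z)
    (f g : morphism X Y) :
  morphism_eq f g -> morphism_eq (morphism_comp e f) (morphism_comp e g).
Proof.
move=> [e1 e2]; split=> [x|V s W hf hg]; first by rewrite /= e1.
rewrite /= (res_comp _ _ (hf : W `<=` pre f (pre e V))).
rewrite (res_comp _ _ (hg : W `<=` pre g (pre e V))).
exact: e2.
Qed.

Lemma morphism_comp_congl (X Y Z : ringed_space) (e : morphism X Y)
    (f g : morphism Y Z) :
  morphism_eq f g -> morphism_eq (morphism_comp f e) (morphism_comp g e).
Proof.
move=> [e1 e2]; split=> [x|V s W hf hg]; first by rewrite /= e1.
rewrite /= (res_comp _ _ (hf : W `<=` pre e (pre f V))).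
rewrite (res_comp _ _ (hg : W `<=` pre e (pre g V))).
pose N := opensI (pre f V) (pre g V).
have nf : N `<=` pre f V by move=> y [].
have ng : N `<=` pre g V by move=> y [].
have WN : W `<=` pre e N by move=> x Wx; split; [exact: hf|exact: hg].
by rewrite -(res_mpull nf _ _ WN) -(res_mpull ng _ _ WN) e2.
Qed.

Lemma comp_morphism_id (X Y : ringed_space) (f : morphism X Y) :
  morphism_eq (morphism_comp (morphism_id Y) f) f.
Proof.
split=> // V s W hf hg.
rewrite /= (res_comp _ _ (hf : W `<=` pre f (pre (morphism_id Y) V))).
exact: res_mpull.
Qed.

Lemma germ_unit_pull (X Y : ringed_space) (f : morphism X Y) (V : opens Y)
    (s : sec V) (x : X) :
  germ_unit s (f x) -> germ_unit (mpull f V s) x.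
Proof.
move=> [W [h [t [Wx e]]]].
have h' : pre f W `<=` pre f V by move=> y /h.
exists (pre f W), h', (mpull f W t); split=> //.
by rewrite mpull_res -rmorphM e rmorph1.
Qed.

End MorphismEq.

Section SpecMorphisms.

Lemma Spec_map_comp (A B C : comNzRingType) (f : {rmorphism A -> B})
    (g : {rmorphism B -> C}) (h : {rmorphism A -> C}) :
  (forall a, h a = g (f a)) ->
  morphism_eq (Spec_map h) (morphism_comp (Spec_map f) (Spec_map g)).
Proof.
move=> e; have ec q : comap h q = comap f (comap g q).
  by apply: spec_eq => a; rewrite !in_comap e.
split=> [q|V s W hf hg]; first exact: ec.
apply: spec_sec_eq => q Wq /=.
move: (hf q Wq) (hg q Wq) => /=; rewrite /Defs.preim /=.
move=> h1 h2.
have [N [a [u [Np NV sE]]]] := spec_secP s h2.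
rewrite (sval_at_irr s _ h2); have [u2 ->] := sE _ h2 Np.
have N1 : oset N (comap h q) by rewrite ec.
have [u1 ->] := sE _ h1 N1.
rewrite !loc_mapE; apply/frac_eq; exists 1; first exact: spec1.
by rewrite !e; ring.
Qed.

Lemma Spec_map_ext (A B : comNzRingType) (f g : {rmorphism A -> B}) :
  f =1 g -> morphism_eq (Spec_map f) (Spec_map g).
Proof.
move=> e; have h : morphism_eq (Spec_map f)
    (morphism_comp (Spec_map (@idfun A)) (Spec_map g)).
  exact: Spec_map_comp.
apply: morphism_eq_trans h _; apply: morphism_eq_sym; exact: Spec_map_comp.
Qed.

Lemma germ_unit_cst (A : comNzRingType) (U : opens (Spec A)) (a : A)
    (p : Spec A) :
  oset U p -> @germ_unit (Spec A) U (cst_sec U a) p <-> a \notin (p : spec A).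
Proof.
move=> Up; split.
  move=> [W [h [t [Wp /(congr1 (fun r => sval_at r Wp)) /=]]]].
  have [b [g [gp ->]]] := fracP (sval_at t Wp).
  rewrite fracM => /frac_eq[u up].
  rewrite mulr1 !mul1r => e; apply/negP => ap.
  suff : u * g \in (p : spec A) by apply/negP; apply: specMn.
  have -> : u * g = u * b * a - u * (a * b - g) by ring.
  by rewrite e subr0; apply: specMl.
move=> ap.
pose M := opensI U (Opens (basic_open_open a)).
have hM : M `<=` U by move=> r [].
have iP : @locally_fraction A M (fun r Mr => Defs.frac 1 (Mr.2 : a \notin r)).
  by move=> r Mr; exists M, 1, a; split=> // r' Mr' _; exists Mr'.2.
exists M, hM, (SpecSec iP); split; first by split.
apply: spec_sec_eq => r Mr /=; rewrite fracM;
  apply/frac_eq; exists 1; first exact: spec1.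
by ring.
Qed.

End SpecMorphisms.

(** * Morphisms from the spectrum of a local ring *)

Section LocalRing.
Variables (L : comNzRingType) (m : spec L).

(** [m] is the maximal ideal of a local ring. Inverses are given as existential
witnesses, so that [L] need not carry a [unitRingType] structure. *)
Definition local_at := forall f : L, f \notin m -> exists g, f * g = 1.

Hypothesis loc_m : local_at.

(** Every point of the spectrum specializes to the closed point. *)
Lemma open_local (U : opens (Spec L)) (q : spec L) : oset U m -> oset U q.
Proof.
case: (oset_open U) => E -> /= [f Ef /loc_m [g fg]]; exists f => //.
by apply/negP => /(specMl g); rewrite mulrC fg; apply/negP/spec1.
Qed.

(** A neighbourhood of the closed point is the whole spectrum, where a section
that is the fraction [a / f] near [m] has an invertible denominator. *)
Lemma frac_local (U : opens (Spec L)) (s : @sec (Spec L) U) : oset U m ->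
  exists a, s = cst_sec U a.
Proof.
move=> Um; have [W [a [f [Wm WU sE]]]] := spec_secP s Um.
have [fm _] := sE m Um Wm; have [g fg] := loc_m fm.
exists (a * g); apply: spec_sec_eq => q Uq /=.
have [fq ->] := sE q Uq (open_local q Wm).
apply/frac_eq; exists 1; first exact: spec1.
rewrite mulr1 mul1r -mulrA [g * f]mulrC fg; ring.
Qed.

Lemma cst_sec_inj (U : opens (Spec L)) (a b : L) : oset U m ->
  cst_sec U a = cst_sec U b -> a = b.
Proof.
move=> Um /(congr1 (fun r => sval_at r Um)) /= /frac_eq[u /loc_m [g ug]].
rewrite !mulr1 => e; apply/eqP; rewrite -subr_eq0; apply/eqP.
by rewrite -[LHS]mul1r -ug mulrAC e mul0r.
Qed.

End LocalRing.

Lemma cst_sec_is_zmod_morphism (A : comNzRingType) (U : opens (spec A)) :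
  zmod_morphism (cst_sec U).
Proof.
move=> a b; apply: spec_sec_eq => p Up /=; rewrite fracN fracD.
by apply/frac_eq; exists 1; [exact: spec1 | ring].
Qed.

Lemma cst_sec_is_monoid_morphism (A : comNzRingType) (U : opens (spec A)) :
  monoid_morphism (cst_sec U).
Proof.
split=> // a b; apply: spec_sec_eq => p Up /=; rewrite fracM.
by apply/frac_eq; exists 1; [exact: spec1 | ring].
Qed.

HB.instance Definition _ (A : comNzRingType) (U : opens (spec A)) :=
  GRing.isZmodMorphism.Build A (spec_sec U) (cst_sec U)
    (@cst_sec_is_zmod_morphism A U).
HB.instance Definition _ (A : comNzRingType) (U : opens (spec A)) :=
  GRing.isMonoidMorphism.Build A (spec_sec U) (cst_sec U)
    (@cst_sec_is_monoid_morphism A U).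

(** A morphism [g] from the spectrum of a local ring that sends the closed point
into an affine chart [j : Spec A -> X] lands in this chart, and is there given
by a ring morphism: an element of [A] is a section of [X] over the chart, its
pull-back by [g] is a section over the whole of [Spec L], and thus an element of
[L]. *)
Section Factor.
Variables (X : ringed_space) (A L : comNzRingType) (m : spec L).
Hypothesis loc_m : local_at m.
Variables (g : morphism (Spec L) X) (j : morphism (Spec A) X).
Hypothesis (oj : open_immersion j) (gm : range j (g m)).

Lemma open_range : open (range j).
Proof. by case: oj => _ /(_ setT openT). Qed.

Let R : opens X := Opens open_range.

Lemma chart_lift_subproof (a : A) : exists s : @sec X R, mpull j R s = cst_sec _ a.
Proof.
case: oj => _ _ /(_ R (@subset_refl _ _))[f _ fK].
by exists (f (cst_sec _ a)); rewrite fK.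
Qed.

Definition chart_lift a : @sec X R := sval (cid (chart_lift_subproof a)).
Lemma chart_liftE a : mpull j R (chart_lift a) = cst_sec _ a.
Proof. exact: (svalP (cid (chart_lift_subproof a))). Qed.

Let inj_j (V : opens X) : V `<=` range j -> injective (mpull j V).
Proof. by case: oj => _ _ h /h /bij_inj. Qed.

Lemma factor_subproof (a : A) : exists b : L, mpull g R (chart_lift a) = cst_sec _ b.
Proof. exact: (frac_local loc_m). Qed.

Definition factor a : L := sval (cid (factor_subproof a)).
Lemma factorE a : mpull g R (chart_lift a) = cst_sec _ (factor a).
Proof. exact: (svalP (cid (factor_subproof a))). Qed.

Lemma factor_zmod : zmod_morphism factor.
Proof.
move=> a b; apply: (cst_sec_inj loc_m (gm : oset (pre g R) m)).
apply: etrans (esym (factorE (a - b))) _.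
transitivity (mpull g R (chart_lift a - chart_lift b)).
  congr (mpull g _ _); apply: (inj_j (@subset_refl _ R)).
  rewrite rmorphB !chart_liftE; exact: cst_sec_is_zmod_morphism.
rewrite rmorphB !factorE; exact/esym/cst_sec_is_zmod_morphism.
Qed.

Lemma factor_monoid : monoid_morphism factor.
Proof.
split=> [|a b]; apply: (cst_sec_inj loc_m (gm : oset (pre g R) m)).
  apply: etrans (esym (factorE 1)) _.
  apply: etrans _ (rmorph1 (mpull g R)).
  congr (mpull g _ _); apply: (inj_j (@subset_refl _ R)).
  by rewrite rmorph1 chart_liftE.
apply: etrans (esym (factorE (a * b))) _.
transitivity (mpull g R (chart_lift a * chart_lift b)).
  congr (mpull g _ _); apply: (inj_j (@subset_refl _ R)).
  rewrite rmorphM !chart_liftE; exact: (cst_sec_is_monoid_morphism _).2.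
rewrite rmorphM !factorE; exact/esym/(cst_sec_is_monoid_morphism _).2.
Qed.

HB.instance Definition _ := GRing.isZmodMorphism.Build A L factor factor_zmod.
HB.instance Definition _ := GRing.isMonoidMorphism.Build A L factor factor_monoid.

(** A section over the chart is invertible at [j p] iff it is not in [p], and
invertible at [g q] iff its pull-back is not in [q], morphisms being local. *)
Lemma factor_point (q : spec L) : g q = j (comap factor q).
Proof.
have [p _ jp] : range j (g q) := open_local loc_m (U := pre g R) q gm.
rewrite -jp; congr (j _); apply: spec_eq => a; rewrite in_comap; apply: negb_inj.
have Rp : oset (pre j R) p by exists p.
have Rq : oset (pre g R) q by exists p.
apply/idP/idP.
  move/(germ_unit_cst a Rp); rewrite -chart_liftE => /mlocal => /(_ Rp).
  by rewrite jp => /germ_unit_pull; rewrite factorE => /germ_unit_cst; apply.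
move/(germ_unit_cst _ Rq); rewrite -factorE => /mlocal => /(_ Rq).
by rewrite -jp => /germ_unit_pull; rewrite chart_liftE => /germ_unit_cst; apply.
Qed.

Lemma factor_chart : exists psi : {rmorphism A -> L},
  morphism_eq g (morphism_comp j (Spec_map psi)).
Proof.
exists factor; split=> [q|V s W hf hg]; first exact: factor_point.
apply: spec_sec_eq => q Wq /=.
set hq := hf q Wq.
have Vp : oset (pre j V) (comap factor q) by exact: hg.
rewrite (sval_at_irr _ _ Vp).
have [N [a [f [Np NV sE]]]] := spec_secP (mpull j V s) Vp.
have [fp ->] := sE _ Vp Np.
have oN : open (j @` N) by case: oj => _ + _; apply; apply: oset_open.
pose N' : opens X := Opens oN.
have hNV : N' `<=` V by move=> _ [p Np' <-]; apply: NV.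
have hNR : N' `<=` R by move=> _ [p _ <-]; exists p.
(* Near [g q] the relation [f * s = a] of sections of the chart is already a
   relation of sections of [X], which can be pulled back by [g]. *)
have key : res hNR (chart_lift f) * res hNV s = res hNR (chart_lift a).
  apply: (@inj_j N') => //; rewrite rmorphM.
  have h1 : pre j N' `<=` pre j V by move=> p /hNV.
  have h2 : pre j N' `<=` pre j R by move=> p /hNR.
  rewrite -(mpull_res hNV h1) -!(mpull_res hNR h2) !chart_liftE.
  apply: spec_sec_eq => p Np' /=.
  have Np2 : oset N p by case: Np' => p' Np' e; case: oj => /(_ _ _ e) <-.
  have [f2 ->] := sE p (h1 p Np') Np2.
  rewrite fracM; apply/frac_eq; exists 1; first exact: spec1.
  by ring.
have Nq : oset (pre g N') q by exists (comap factor q) => //; rewrite -factor_point.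
have h1 : pre g N' `<=` pre g V by move=> p /hNV.
have h2 : pre g N' `<=` pre g R by move=> p /hNR.
have := congr1 (fun r => sval_at (mpull g N' r) Nq) key.
rewrite rmorphM -(mpull_res hNV h1) -!(mpull_res hNR h2) !factorE /=.
rewrite (sval_at_irr _ _ hq).
have [b [c [cq ->]]] := fracP (sval_at (mpull g V s) hq).
rewrite loc_mapE fracM => /frac_eq[u uq].
rewrite !mulr1 mul1r => e; apply/frac_eq; exists u => //.
by rewrite -e; ring.
Qed.

End Factor.

(** * The local ring at a prime *)

Section LocRing.
Variables (A : comNzRingType) (a : spec A).

Lemma loc_nonzero : (1 : loc a) != 0.
Proof.
apply/eqP; rewrite frac0 frac1 => /frac_eq[u ua]; rewrite mulr1 mul0r subr0 => e.
by move: ua; rewrite -[u]mulr1 e spec0.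
Qed.

HB.instance Definition _ :=
  GRing.PzSemiRing_isNonZero.Build (loc a) loc_nonzero.

Definition to_loc (x : A) : loc a := Defs.frac x (spec1 a).

Lemma to_loc_is_zmod_morphism : zmod_morphism to_loc.
Proof.
move=> x y; rewrite /to_loc fracN fracD.
by apply/frac_eq; exists 1; [exact: spec1 | ring].
Qed.

Lemma to_loc_is_monoid_morphism : monoid_morphism to_loc.
Proof.
split=> // x y; rewrite /to_loc fracM.
by apply/frac_eq; exists 1; [exact: spec1 | ring].
Qed.

HB.instance Definition _ := GRing.isZmodMorphism.Build A (loc a) to_loc
  to_loc_is_zmod_morphism.
HB.instance Definition _ := GRing.isMonoidMorphism.Build A (loc a) to_loc
  to_loc_is_monoid_morphism.

Lemma frac_to_loc x f (fa : f \notin a) : Defs.frac x fa * to_loc f = to_loc x.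
Proof.
rewrite fracM; apply/frac_eq; exists 1; [exact: spec1 | ring].
Qed.

Lemma to_loc_unit f : f \notin a -> exists g, to_loc f * g = 1.
Proof.
move=> fa; exists (Defs.frac 1 fa); rewrite mulrC frac_to_loc.
by rewrite /to_loc.
Qed.

Definition loc_max_pred (x : loc a) : bool :=
  `[< exists y f (fa : f \notin a), y \in a /\ x = Defs.frac y fa >].

Lemma loc_max_frac y f (fa : f \notin a) :
  loc_max_pred (Defs.frac y fa) = (y \in a).
Proof.
apply/asboolP/idP => [[z [g [ga [za /frac_eq[u ua e]]]]]|ya]; last by exists y, f, fa.
have : u * g * y \in a.
  have -> : u * g * y = u * f * z + (u * (y * g - z * f)) by ring.
  by rewrite e addr0; apply: specMl.
by rewrite specM (negbTE (specMn ua ga)).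
Qed.

Lemma loc_max_idealr : idealr_closed loc_max_pred.
Proof.
split.
- by rewrite -topredE /= frac0 loc_max_frac spec0.
- by rewrite -topredE /= frac1 loc_max_frac spec1.
move=> x u v; have [b [f [fa ->]]] := fracP x; have [c [g [ga ->]]] := fracP u.
have [d [h [ha ->]]] := fracP v.
rewrite -!topredE /= fracM fracD !loc_max_frac => ca da.
case: (spec_idealr a) => _ _ L.
have -> : b * c * h + d * (f * g) = (h * b) * c + (f * g) * d by ring.
by apply: (L (h * b) c) => //; apply: specMl.
Qed.

Lemma loc_max_prime : prime_idealr_closed loc_max_pred.
Proof.
move=> u v; have [c [g [ga ->]]] := fracP u; have [d [h [ha ->]]] := fracP v.
by rewrite -!topredE /= fracM !loc_max_frac specM.
Qed.

Definition loc_max : spec (loc a) := SpecPoint loc_max_idealr loc_max_prime.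

Lemma loc_max_local : local_at loc_max.
Proof.
move=> x; have [c [g [ga ->]]] := fracP x; rewrite -topredE /= loc_max_frac => ca.
exists (Defs.frac g ca); rewrite fracM.
by apply/frac_eq; exists 1; [exact: spec1 | ring].
Qed.

Lemma comap_loc_max : comap to_loc loc_max = a.
Proof.
by apply: spec_eq => x; rewrite in_comap; apply: loc_max_frac.
Qed.

Lemma comap_to_loc_inj : injective (comap to_loc).
Proof.
move=> p q e; apply: spec_eq => x; have [c [g [ga ->]]] := fracP x.
have h (r : spec (loc a)) : (Defs.frac c ga \in r) = (c \in comap to_loc r).
  rewrite in_comap /= -(frac_to_loc c ga) specM orb_idr // => gr.
  have [u e1] := to_loc_unit ga.
  by case/negP: (spec1 r); rewrite -e1 mulrC; apply: specMl.
by rewrite !h e.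
Qed.

(** The universal property of localization. *)
Section Extend.
Variables (L : comNzRingType) (psi : {rmorphism A -> L}).
Hypothesis psi_unit : forall f, f \notin a -> exists g, psi f * g = 1.

Lemma loc_ext_subproof (x : loc a) :
  exists l, forall y f (fa : f \notin a), x = Defs.frac y fa -> l * psi f = psi y.
Proof.
have [c [g [ga ->]]] := fracP x; have [i gi] := psi_unit ga.
exists (psi c * i) => y f fa /frac_eq[u ua e].
have [v uv] := psi_unit ua.
have e' : psi u * (psi c * psi f - psi y * psi g) = 0.
  by rewrite -!rmorphM -rmorphB -rmorphM e rmorph0.
have e2 : psi c * psi f = psi y * psi g.
  apply/eqP; rewrite -subr_eq0; apply/eqP.
  by rewrite -[LHS]mul1r -uv mulrAC e' mul0r.
by rewrite mulrAC e2 -mulrA gi mulr1.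
Qed.

Definition loc_ext (x : loc a) : L := sval (cid (loc_ext_subproof x)).

Lemma loc_extE y f (fa : f \notin a) : loc_ext (Defs.frac y fa) * psi f = psi y.
Proof. exact: (svalP (cid (loc_ext_subproof _))). Qed.

Lemma loc_ext_uniq y f (fa : f \notin a) l :
  l * psi f = psi y -> l = loc_ext (Defs.frac y fa).
Proof.
rewrite -(loc_extE y fa) => e; have [i gi] := psi_unit fa.
by rewrite -[l]mulr1 -gi mulrA e -mulrA gi mulr1.
Qed.

Lemma loc_ext_is_zmod_morphism : zmod_morphism loc_ext.
Proof.
move=> x y; have [c [g [ga ->]]] := fracP x; have [d [h [ha ->]]] := fracP y.
rewrite fracN fracD; apply/esym/loc_ext_uniq.
rewrite rmorphD !rmorphM rmorphN -(loc_extE c ga) -(loc_extE d ha); ring.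
Qed.

Lemma loc_ext_is_monoid_morphism : monoid_morphism loc_ext.
Proof.
split=> [|x y].
  by rewrite frac1; apply/esym/loc_ext_uniq; rewrite mul1r.
have [c [g [ga ->]]] := fracP x; have [d [h [ha ->]]] := fracP y.
rewrite fracM; apply/esym/loc_ext_uniq.
rewrite !rmorphM -(loc_extE c ga) -(loc_extE d ha); ring.
Qed.

HB.instance Definition _ := GRing.isZmodMorphism.Build (loc a) L loc_ext
  loc_ext_is_zmod_morphism.
HB.instance Definition _ := GRing.isMonoidMorphism.Build (loc a) L loc_ext
  loc_ext_is_monoid_morphism.

Lemma loc_ext_to_loc x : loc_ext (to_loc x) = psi x.
Proof. by apply/esym/loc_ext_uniq; rewrite rmorph1 mulr1. Qed.

End Extend.

Section Algebra.
Variables (k : comNzRingType) (kappa : {rmorphism k -> loc a}).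

(** A copy of [loc a] that carries the [k]-algebra structure given by [kappa]. *)
Definition loc_alg : Type := loc a.
HB.instance Definition _ := GRing.ComNzRing.on loc_alg.

Definition loc_alg_scale (c : k) (x : loc_alg) : loc_alg := (kappa c * x).

Lemma loc_alg_scaleA c d x :
  loc_alg_scale c (loc_alg_scale d x) = loc_alg_scale (c * d) x.
Proof. by rewrite /loc_alg_scale rmorphM mulrA. Qed.
Lemma loc_alg_scale1 : left_id 1 loc_alg_scale.
Proof. by move=> x; rewrite /loc_alg_scale rmorph1 mul1r. Qed.
Lemma loc_alg_scaleDr : right_distributive loc_alg_scale +%R.
Proof. by move=> c x y; rewrite /loc_alg_scale mulrDr. Qed.
Lemma loc_alg_scaleDl x : {morph loc_alg_scale^~ x : c d / c + d}.
Proof. by move=> c d; rewrite /loc_alg_scale rmorphD mulrDl. Qed.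

HB.instance Definition _ := GRing.Zmodule_isLmodule.Build k loc_alg
  loc_alg_scaleA loc_alg_scale1 loc_alg_scaleDr loc_alg_scaleDl.

Lemma loc_alg_scaleAl (c : k) (x y : loc_alg) : c *: (x * y) = c *: x * y.
Proof. exact: (mulrA (kappa c) x y). Qed.

HB.instance Definition _ := GRing.Lmodule_isLalgebra.Build k loc_alg loc_alg_scaleAl.

Lemma loc_alg_scaleAr (c : k) (x y : loc_alg) : c *: (x * y) = x * (c *: y).
Proof. exact: (mulrCA (kappa c) x y). Qed.

HB.instance Definition _ := GRing.Lalgebra_isAlgebra.Build k loc_alg loc_alg_scaleAr.

Definition loc_algType : comAlgType k := loc_alg.

Lemma in_alg_loc (c : k) : in_alg loc_algType c = kappa c.
Proof. exact: mulr1. Qed.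

End Algebra.

End LocRing.

(** * The local scheme at a point of a scheme *)

Section StalkModel.
Variables (k : comNzRingType) (X : ringed_space) (sX : morphism X (Spec k)).

Lemma morphism_id_immersion (Y : ringed_space) : open_immersion (morphism_id Y).
Proof.
split=> [//|W oW|V _]; last exact: id_pull_bij.
by rewrite (_ : _ @` W = W) // image_id.
Qed.

(** The case of [factor_chart] where the chart is the identity. *)
Lemma to_affine (A L : comNzRingType) (m : spec L) (loc_m : local_at m)
    (g : morphism (Spec L) (Spec A)) :
  exists psi : {rmorphism A -> L}, morphism_eq g (Spec_map psi).
Proof.
have gm : range (morphism_id (Spec A)) (g m) by exists (g m).
have [psi e] := factor_chart loc_m (@morphism_id_immersion _) gm.
exists psi; apply: morphism_eq_trans e _; exact: comp_morphism_id.
Qed.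

Lemma Spec_map_inj (A L : comNzRingType) (m : spec L) (loc_m : local_at m)
    (f g : {rmorphism A -> L}) :
  morphism_eq (Spec_map f) (Spec_map g) -> f =1 g.
Proof.
move=> [e1 e2] a.
pose T : opens (Spec A) := Opens openT.
pose T' : opens (Spec L) := Opens openT.
have hf : T' `<=` pre (Spec_map f) T by [].
have hg : T' `<=` pre (Spec_map g) T by [].
have Tm : oset T' m by [].
have /(congr1 (fun r => sval_at r Tm)) := e2 T (cst_sec T a) T' hf hg.
rewrite /= !loc_mapE => /frac_eq[u /loc_m [v uv]].
rewrite !rmorph1 !mulr1 => e; apply/eqP; rewrite -subr_eq0; apply/eqP.
by rewrite -[LHS]mul1r -uv mulrAC e mul0r.
Qed.

(** [B] is the local ring of [X] at [x]. A morphism from a local scheme whose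
closed point goes to a generization of [x] factors through [Spec B]: if
[j : Spec A -> X] is a chart with [j a = x], an element of [A] outside [a] is
invertible on a neighbourhood of [x], hence becomes a unit in the local ring
[C], so that the ring morphism [A -> C] of the chart extends to [loc a]. *)
Lemma stalk_model (X_scheme : is_scheme X) (x : X) :
  exists (B : comAlgType k) (m : spec B) (f : kmorphism sX B),
  [/\ local_at m, f m = x, injective f &
      forall (C : comAlgType k) (q : spec C) (g : kmorphism sX C), local_at q ->
        (forall W : opens X, oset W x -> oset W (g q)) ->
        exists phi : {lrmorphism B -> C},
          morphism_eq g (morphism_comp f (Spec_map phi))].
Proof.
have [A [j [oj [a _ ja]]]] := X_scheme x.
pose c := morphism_comp j (Spec_map (@to_loc A a)).
have [kappa ek] := to_affine (@loc_max_local A a) (morphism_comp sX c).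
pose B : comAlgType k := loc_algType kappa.
have ov : morphism_eq (morphism_comp sX (c : morphism (Spec B) X))
    (Spec_map (in_alg B : {rmorphism k -> B})).
  apply: morphism_eq_trans ek _; apply: Spec_map_ext => y.
  exact: esym (in_alg_loc kappa y).
exists B, (@loc_max A a), (KMorphism ov); split.
- exact: loc_max_local.
- by rewrite /= comap_loc_max.
- move=> p q /= e; apply: comap_to_loc_inj; case: oj => jI _ _; exact: jI.
move=> C q g loc_q gen.
have [jI jO _] := oj.
have Rx : oset (Opens (open_range oj)) x by exists a.
have [p _ jp] : range j (g q) by exact: (gen _ Rx).
have gq : range j (g q) by exists p.
have [psi e] := factor_chart loc_q oj gq.
have psi_unit f : f \notin a -> exists v, psi f * v = 1.
  move=> fa; apply: loc_q.
  have Df : oset (Opens (jO _ (basic_open_open f))) x by exists a.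
  have [r fr jr] := gen _ Df.
  have : r = comap psi q by apply: jI; rewrite jr; case: e => + _; apply.
  by move=> er; move: fr; rewrite /basic_open /= er.
pose phi : {rmorphism loc a -> C} := loc_ext psi_unit.
have phiE y : psi y = phi (to_loc a y) by rewrite /= loc_ext_to_loc.
have e2 : morphism_eq g (morphism_comp c (Spec_map phi)).
  apply: morphism_eq_trans e _.
  apply: morphism_eq_trans (morphism_compA _ _ _).
  exact/morphism_comp_congr/Spec_map_comp.
have phik (y : k) : phi (kappa y) = in_alg C y.
  have : morphism_eq (Spec_map ([the {rmorphism k -> C} of phi \o kappa]))
     (Spec_map (in_alg C : {rmorphism k -> C})).
    apply: morphism_eq_trans (kmor_over g).
    apply: morphism_eq_trans (morphism_comp_congr sX (morphism_eq_sym e2)).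
    apply: morphism_eq_trans (morphism_eq_sym (morphism_compA _ _ _)).
    apply: morphism_eq_trans (morphism_comp_congl _ (morphism_eq_sym ek)).
    exact: Spec_map_comp.
  by move/(Spec_map_inj loc_q)/(_ y).
have phiZ : scalable (phi : B -> C).
  move=> y v; rewrite /= -[RHS]mulr_algl -[X in X * _]phik.
  exact: rmorphM.
pose lin := GRing.isScalable.Build k B C *:%R phi phiZ.
pose phiB : {lrmorphism B -> C} := HB.pack (phi : B -> C) lin
  (GRing.RMorphism.class phi).
by exists phiB.
Qed.

End StalkModel.

(** * The generic point *)

Section GenericPoint.
Variable X : ringed_space.
Hypotheses (X_scheme : is_scheme X) (X_irr : irreducible_space X).

Lemma irreducible_openI (U V : set X) :
  open U -> open V -> U !=set0 -> V !=set0 -> U `&` V !=set0.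
Proof.
move=> oU oV [u Uu] [v Vv]; apply/set0P/negP => /eqP UV0.
have [_ /(_ (~` U) (~` V))] := X_irr.
rewrite -setCI UV0 setC0 => /(_ (open_closedC oU) (open_closedC oV) erefl).
by case=> /seteqP[_ h]; [case: (h u) | case: (h v)].
Qed.

(** In a chart [Spec A] the elements contained in all primes form a prime ideal,
because two nonempty basic open sets meet. Taking this ideal, rather than the
nilpotent elements, avoids the existence of primes in a nonzero ring. *)
Lemma generic_point : exists eta : X, forall W : opens X, W !=set0 -> oset W eta.
Proof.
have [[x _] _] := X_irr.
have [A [j [[jI jO _] [a _ ja]]]] := X_scheme x.
pose nil (f : A) : bool := `[< forall p : spec A, f \in p >].
have nilP f : reflect (forall p : spec A, f \in p) (nil f) by apply: asboolP.
have nil_ideal : idealr_closed nil.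
  split.
  - by apply/nilP => p; apply: spec0.
  - by apply/negP => /nilP /(_ a); apply/negP/spec1.
  move=> r u v /nilP hu /nilP hv; apply/nilP => p.
  by case: (spec_idealr p) => _ _; apply.
have nil_prime : prime_idealr_closed nil.
  move=> u v uv; apply: contraT; rewrite negb_or => /andP[/nilP hu /nilP hv].
  have ne f : ~ (forall p : spec A, f \in p) -> j @` basic_open f !=set0.
    by move=> /existsNP[p /negP fp]; exists (j p), p.
  have [_ [[p pu <-] [q qv /jI e]]] :=
    irreducible_openI (jO _ (basic_open_open u)) (jO _ (basic_open_open v))
      (ne _ hu) (ne _ hv).
  rewrite e {q e} in qv.
  have : u * v \in p by move/nilP: uv; apply.
  by rewrite specM => /orP[h|h]; [case/negP: pu | case/negP: qv].
pose e : spec A := SpecPoint nil_ideal nil_prime.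
exists (j e) => W W0.
have [y [Wy [p _ jp]]] : W `&` range j !=set0.
  by apply: irreducible_openI => //; [exact: oset_open|exact: jO openT|exists x, a].
have : open (j @^-1` W) by apply: open_comp (oset_open W) => q _; apply: mcont.
move=> [E WE]; have : (j @^-1` W) p by rewrite /= jp.
rewrite WE => -[f Ef fp]; have : (j @^-1` W) e; last by [].
by rewrite WE; exists f => //; apply/negP => /nilP /(_ p); apply/negP.
Qed.

End GenericPoint.

Section FieldPoint.
Variable K : fieldType.

Lemma field_pt_ideal : idealr_closed (fun x : K => x == 0).
Proof.
split; rewrite -?topredE /= ?eqxx ?oner_eq0 //.
by move=> r u v; rewrite -!topredE /= => /eqP -> /eqP ->; rewrite mulr0 addr0.
Qed.

Lemma field_pt_prime : prime_idealr_closed (fun x : K => x == 0).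
Proof. by move=> u v; rewrite -!topredE /= mulf_eq0. Qed.

Definition field_pt : spec K := SpecPoint field_pt_ideal field_pt_prime.

Lemma field_pt_local : local_at field_pt.
Proof. by move=> f; rewrite -topredE /= => f0; exists f^-1; rewrite divff. Qed.

End FieldPoint.

Section TwoPoints.
Variables (k : fieldType) (X : ringed_space) (sX : morphism X (Spec k)).
Hypotheses (X_scheme : is_scheme X) (X_irr : irreducible_space X).

(** [L] is the local ring at the generic point and [B] the local ring at the
image of [R]; [phi] is the reduction of [B] to the residue field [k] and [psi]
the localization at the generic point. *)
Lemma common_generization (P Q : kmorphism sX k^o) :
  exists (L : comAlgType k) (m : spec L) (g : kmorphism sX L),
  local_at m /\ forall R, R = P \/ R = Q ->
  exists (B : comAlgType k) (f : kmorphism sX B)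
    (phi : {lrmorphism B -> k^o}) (psi : {lrmorphism B -> L}),
    [/\ forall b, phi b != 0 -> exists c, b * c = 1,
        morphism_eq R (morphism_comp f (Spec_map phi)) &
        morphism_eq g (morphism_comp f (Spec_map psi))].
Proof.
have [eta etaP] := generic_point X_scheme X_irr.
have [L [m [g [loc_m gm _ _]]]] := stalk_model sX X_scheme eta.
exists L, m, g; split=> // R _.
pose pt : spec (k^o : comAlgType k) := @field_pt k.
have [B [q [f [loc_q fq fI fact]]]] := stalk_model sX X_scheme (R pt).
have loc_pt : local_at pt by exact: field_pt_local.
have [phi ephi] := fact k^o pt R loc_pt (fun _ h => h).
have [|psi epsi] := fact L m g loc_m.
  by move=> W Wx; rewrite gm; apply: etaP; exists (R pt).
exists B, f, phi, psi; split=> // b phib; apply: loc_q.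
have <- : comap phi pt = q by apply: fI; rewrite fq; case: ephi => + _; move=> ->.
exact: phib.
Qed.

End TwoPoints.

(** * Free modules over local rings *)

Section Combinations.
Variables (n d : nat) (B : comNzRingType) (M : lmodType {mpoly B[n]}).
Implicit Types (a b : 'rV[B]_d) (w : 'I_d -> M).

Definition comb a w : M := \sum_i (a 0 i)%:MP *: w i.

Definition spans w := forall x, exists a, x = comb a w.
Definition independent w := forall a, comb a w = 0 -> a = 0.

Lemma combD a b w : comb (a + b) w = comb a w + comb b w.
Proof.
by rewrite -big_split; apply: eq_bigr => i _ /=; rewrite mxE mpolyCD scalerDl.
Qed.

Lemma combZ c a w : comb (c *: a) w = c%:MP *: comb a w.
Proof.
by rewrite scaler_sumr; apply: eq_bigr => i _ /=; rewrite mxE mpolyCM scalerA.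
Qed.

Lemma comb0 w : comb 0 w = 0.
Proof. by rewrite /comb big1 // => i _; rewrite mxE mpolyC0 scale0r. Qed.

Lemma comb_sum (I : Type) (r : seq I) (P : pred I) (F : I -> 'rV[B]_d) w :
  comb (\sum_(i <- r | P i) F i) w = \sum_(i <- r | P i) comb (F i) w.
Proof. by apply: (big_morph (comb^~ w)); [move=> *; apply: combD|apply: comb0]. Qed.

Lemma comb_mulmx a (C : 'M[B]_d) w :
  comb (a *m C) w = comb a (fun i => comb (row i C) w).
Proof.
rewrite mulmx_sum_row comb_sum; apply: eq_bigr => i _; exact: combZ.
Qed.

Lemma combB a b w : comb (a - b) w = comb a w - comb b w.
Proof. by rewrite combD -[- b]scaleN1r combZ mpolyCN mpolyC1 scaleN1r. Qed.

Lemma independent_inj w a b : independent w -> comb a w = comb b w -> a = b.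
Proof.
move=> iw e; apply/eqP; rewrite -subr_eq0; apply/eqP/iw.
by rewrite combB e subrr.
Qed.

Lemma comb_delta i w : comb (delta_mx 0 i) w = w i.
Proof.
rewrite /comb (bigD1 i) //= mxE !eqxx mpolyC1 scale1r big1 ?addr0 // => j ji.
by rewrite mxE (negbTE ji) andbF mpolyC0 scale0r.
Qed.

Lemma span_matrix w (v : 'I_d -> M) : spans w ->
  exists C : 'M[B]_d, forall i, v i = comb (row i C) w.
Proof.
move=> sw.
have /choice[c cE] : forall i, exists a, v i = comb a w by move=> i; apply: sw.
exists (\matrix_i c i) => i; by rewrite rowK.
Qed.

Hypotheses (m : spec B) (loc_m : local_at m) (M_free : locally_free_rank d M).

Lemma local_basis : exists w, spans w /\ independent w.
Proof.
have [f fm [e [sp ind]]] := M_free m; have [g fg] := loc_m fm.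
have gf N : g ^+ N * f ^+ N = 1 by rewrite -exprMn mulrC fg expr1n.
exists e; split=> [x|a a0].
  have [N [c cE]] := sp x; exists (g ^+ N *: \row_i c i).
  rewrite combZ -[LHS]scale1r -[1]/(1%:MP) -(gf N) mpolyCM -scalerA cE.
  by congr (_ *: _); apply: eq_bigr => i _; rewrite mxE.
have [N cE] := ind (a 0) a0.
by apply/rowP => i; rewrite mxE -[LHS]mul1r -(gf N) -mulrA cE mulr0.
Qed.

(** The matrix that expresses [w] in a basis has a one-sided inverse, hence is
invertible. *)
Lemma spans_independent w : spans w -> independent w.
Proof.
move=> sw; have [b [sb ib]] := local_basis.
have [C CE] := span_matrix w sb; have [C' CE'] := span_matrix b sw.
have C'C : C' *m C = 1%:M.
  apply/row_matrixP => i; apply: (independent_inj ib).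
  rewrite row_mul comb_mulmx row1 comb_delta [RHS]CE'.
  by apply: eq_bigr => j _; rewrite -CE.
move=> a a0; have : a *m C = 0.
  apply: ib; rewrite comb_mulmx -[RHS]a0.
  by apply: eq_bigr => j _; rewrite -CE.
by move=> aC; rewrite -[a]mulmx1 -(mulmx1C C'C) mulmxA aC mul0mx.
Qed.

End Combinations.

Section BaseChange.
Variables (n d : nat) (A B : comNzRingType) (phi : {rmorphism A -> B}).
Variables (M : lmodType {mpoly A[n]}) (M' : lmodType {mpoly B[n]}).
Let phiS : {rmorphism {mpoly A[n]} -> {mpoly B[n]}} := map_mpoly phi.
Variable h : {linear M -> M' | phiS \; *:%R}.

Lemma semilinearZ p x : h (p *: x) = phiS p *: h x.
Proof. exact: linearZ. Qed.

Lemma semilinear_sum (I : Type) (r : seq I) (F : I -> M) :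
  h (\sum_(i <- r) F i) = \sum_(i <- r) h (F i).
Proof. exact: raddf_sum. Qed.

Lemma comb_map (a : 'rV[A]_d) (w : 'I_d -> M) :
  h (comb a w) = comb (map_mx phi a) (h \o w).
Proof.
rewrite /comb semilinear_sum; apply: eq_bigr => i _.
by rewrite semilinearZ /phiS /= map_mpolyC mxE.
Qed.

(** Over [B] the images of a spanning family are stable under [S_B], since they
are stable under monomials, which come from [S_A]. *)
Lemma span_scale (w : 'I_d -> M) (p : {mpoly B[n]}) x :
  spans w -> (exists a : 'rV[B]_d, x = comb a (h \o w)) ->
  exists a : 'rV[B]_d, p *: x = comb a (h \o w).
Proof.
move=> sw [a ->]; rewrite [p]mpolyE.
have mon mm : exists C : 'M[A]_d, forall i, 'X_[mm] *: w i = comb (row i C) w.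
  exact: (span_matrix (fun i => 'X_[mm] *: w i) sw).
have /choice[C CE] := mon.
exists (\sum_(mm <- msupp p) p@_mm *: (a *m map_mx phi (C mm))).
rewrite comb_sum scaler_suml; apply: eq_bigr => mm _.
rewrite combZ -mul_mpolyC -scalerA; congr (_ *: _).
rewrite comb_mulmx scaler_sumr; apply: eq_bigr => i _.
rewrite scalerA mulrC -scalerA; congr (_ *: _).
by rewrite -map_row -comb_map -CE semilinearZ /phiS /= map_mpolyX.
Qed.

End BaseChange.

(** If [h (w i)] are independent in the fibre at the closed point, the
determinant of [w] in a basis of [M] is nonzero in the residue field, because a
vector in its left kernel would be a relation between the [h (w i)]; so it is a
unit of [B]. *)
Section Nakayama.
Variables (n d : nat) (B : comNzRingType).
Variables (K : fieldType) (phi : {rmorphism B -> K}).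
Hypothesis phi_unit : forall b, phi b != 0 -> exists c, b * c = 1.
Variables (M : lmodType {mpoly B[n]}) (M' : lmodType {mpoly K[n]}).
Hypothesis M_free : locally_free_rank d M.
Let phiS : {rmorphism {mpoly B[n]} -> {mpoly K[n]}} := map_mpoly phi.
Variable h : {linear M -> M' | phiS \; *:%R}.

Lemma nakayama (w : 'I_d -> M) : independent (h \o w) -> spans w.
Proof.
move=> iw; have loc_m : local_at (comap phi (field_pt K)) by move=> f; apply: phi_unit.
have [b [sb _]] := local_basis loc_m M_free.
have [C CE] := span_matrix w sb.
have [c dc] : exists c, \det C * c = 1.
  apply: phi_unit; rewrite -det_map_mx; apply/eqP => /eqP /det0P[v v0 vC].
  case/eqP: v0; apply: iw.
  rewrite -(comb0 (h \o b)) -vC comb_mulmx; apply: eq_bigr => i _.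
  by rewrite /= CE comb_map map_row.
move=> x; have [a ->] := sb x; exists (a *m (c *: \adj C)).
have aC : a *m (c *: \adj C) *m C = a.
  by rewrite -mulmxA -scalemxAl mul_adj_mx scale_scalar_mx mulrC dc mulmx1.
rewrite -[in LHS]aC comb_mulmx; apply: eq_bigr => i _; by rewrite CE.
Qed.

End Nakayama.

(** * Products of generators in a bilinear triple *)

Section Triple.
Variables (n d r1 r2 : nat).

Section Values.
Variables (A : comNzRingType) (D : bilin_triple n d r1 r2 A).

Definition gen1 (i : 'I_r1) : bM1 D := bp1 D (delta_mx 0 i).
Definition gen2 (i : 'I_r2) : bM2 D := bp2 D (delta_mx 0 i).
Definition prodg (i : 'I_r1) (j : 'I_r2) : bM3 D := bpi D (pure (gen1 i) (gen2 j)).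

Lemma gen1_span x : exists c : 'rV_r1, x = \sum_i c 0 i *: gen1 i.
Proof.
have [v <-] := bp1_surj x; exists v; rewrite {1}[v]row_sum_delta linear_sum.
by apply: eq_bigr => i _; rewrite linearZ.
Qed.

Lemma gen2_span x : exists c : 'rV_r2, x = \sum_i c 0 i *: gen2 i.
Proof.
have [v <-] := bp2_surj x; exists v; rewrite {1}[v]row_sum_delta linear_sum.
by apply: eq_bigr => i _; rewrite linearZ.
Qed.

Lemma piZl p x y : bpi D (pure (p *: x) y) = p *: bpi D (pure x y).
Proof. by rewrite pureZl linearZ. Qed.

Lemma piZr p x y : bpi D (pure x (p *: y)) = p *: bpi D (pure x y).
Proof. by rewrite pureZr linearZ. Qed.

Lemma pi_suml (I : Type) (r : seq I) (F : I -> bM1 D) y :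
  bpi D (pure (\sum_(i <- r) F i) y) = \sum_(i <- r) bpi D (pure (F i) y).
Proof.
apply: (big_morph (fun x => bpi D (pure x y))) => [x x'|].
  by rewrite pureDl linearD.
by rewrite -(scale0r (0 : bM1 D)) piZl scale0r.
Qed.

Lemma pi_sumr (I : Type) (r : seq I) (F : I -> bM2 D) x :
  bpi D (pure x (\sum_(i <- r) F i)) = \sum_(i <- r) bpi D (pure x (F i)).
Proof.
apply: (big_morph (fun y => bpi D (pure x y))) => [y y'|].
  by rewrite pureDr linearD.
by rewrite -(scale0r (0 : bM2 D)) piZr scale0r.
Qed.

(** The products of generators generate [M_3], as [pi], [p_1] and [p_2] are
surjective. *)
Lemma prodg_ind (P : bM3 D -> Prop) :
  P 0 -> (forall x y, P x -> P y -> P (x + y)) ->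
  (forall p x, P x -> P (p *: x)) -> (forall i j, P (prodg i j)) ->
  forall x, P x.
Proof.
move=> P0 PD PZ Pg x; have [z <-] := bpi_surj x; have [s ->] := tsumP z.
rewrite tsumE linear_sum.
have Psum (I : Type) (r : seq I) (F : I -> bM3 D) :
    (forall i, P (F i)) -> P (\sum_(i <- r) F i).
  by move=> PF; elim/big_ind: _.
apply: (Psum) => -[y w] /=.
have [c ->] := gen1_span y; have [e ->] := gen2_span w.
rewrite pi_suml; apply: (Psum) => i; rewrite pi_sumr; apply: (Psum) => j.
by rewrite piZl piZr; apply: (PZ); apply: (PZ); apply: Pg.
Qed.

Definition cyclic_at (i : 'I_r1) := forall x, exists s, x = s *: gen1 i.

End Values.

Section Pullback.
Variables (A B : comNzRingType) (phi : {rmorphism A -> B}).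
Variables (D : bilin_triple n d r1 r2 A) (D' : bilin_triple n d r1 r2 B).
Hypothesis pb : bilin_pullback phi D D'.
Let phiS : {rmorphism {mpoly A[n]} -> {mpoly B[n]}} := map_mpoly phi.

Lemma pullback_gen1 : exists h : {linear bM1 D -> bM1 D' | phiS \; *:%R},
  forall i, h (gen1 D i) = gen1 D' i.
Proof.
have [h1 [h2 [h3 [_ [e1 _ _]]]]] := pb.
exists h1 => i; rewrite /gen1 e1; congr (bp1 D' _); exact: map_delta_mx.
Qed.

Lemma pullback_prodg : exists h : {linear bM3 D -> bM3 D' | phiS \; *:%R},
  forall i j, h (prodg D i j) = prodg D' i j.
Proof.
have [h1 [h2 [h3 [_ [e1 e2 e3]]]]] := pb.
exists h3 => i j; rewrite /prodg /gen1 /gen2 e3 e1 e2.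
by congr (bpi D' (pure (bp1 D' _) (bp2 D' _))); exact: map_delta_mx.
Qed.

Lemma pullback_cyclic i k :
  cyclic_at D i -> exists s, gen1 D' k = s *: gen1 D' i.
Proof.
have [h hE] := pullback_gen1 => /(_ (gen1 D k))[s e]; exists (phiS s).
by rewrite -!hE e semilinearZ.
Qed.

End Pullback.

(** The heart of the matter. The two families [D1] and [D2] become equal over
[L]. As [gen1 D i1 = s1 *: gen1 D i0] and [gen1 D i2 = s2 *: gen1 D i0] over
[L], the matrices [T1] and [T2] describe there the multiplications by [s1] and
[s2] on [M_3]. *)
Lemma cyclic_commute (B1 B2 L : comNzRingType) (m : spec L)
    (psi1 : {rmorphism B1 -> L}) (psi2 : {rmorphism B2 -> L})
    (D1 : bilin_triple n d r1 r2 B1) (D2 : bilin_triple n d r1 r2 B2)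
    (D : bilin_triple n d r1 r2 L)
    (i0 i1 i2 : 'I_r1) (o : 'I_d -> 'I_r2) (T1 T2 : 'M[B2]_d) :
  local_at m -> bilin_pullback psi1 D1 D -> bilin_pullback psi2 D2 D ->
  cyclic_at D1 i0 -> spans (fun j => prodg D2 i0 (o j)) ->
  (forall j, prodg D2 i1 (o j) = comb (row j T1) (fun j => prodg D2 i0 (o j))) ->
  (forall j, prodg D2 i2 (o j) = comb (row j T2) (fun j => prodg D2 i0 (o j))) ->
  map_mx psi2 (T1 *m T2) = map_mx psi2 (T2 *m T1).
Proof.
move=> loc_m pb1 pb2 cyc; set u := fun j => _ => su e1 e2.
have [h hE] := pullback_prodg pb2.
have [s1 g1] := pullback_cyclic pb1 i1 cyc.
have [s2 g2] := pullback_cyclic pb1 i2 cyc.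
pose v := h \o u.
have sv : spans v.
  apply: (@prodg_ind _ D).
  - by exists 0; rewrite comb0.
  - by move=> x y [a ->] [b ->]; exists (a + b); rewrite combD.
  - by move=> p x; apply: span_scale.
  - by move=> i j; have [a e] := su (prodg D2 i j); exists (map_mx psi2 a);
      rewrite -comb_map -e hE.
have iv : independent v by apply: spans_independent loc_m (bM3_free D) _ sv.
have vE j : v j = prodg D i0 (o j) by rewrite /v /= hE.
have act i s T : gen1 D i = s *: gen1 D i0 ->
    (forall j, prodg D2 i (o j) = comb (row j T) u) ->
    forall j, s *: v j = comb (row j (map_mx psi2 T)) v.
  move=> g e j; rewrite -map_row -comb_map -e hE vE.
  by rewrite /prodg g piZl.
have act1 := act _ _ _ g1 e1; have act2 := act _ _ _ g2 e2.
have combs (s : {mpoly L[n]}) (a : 'rV[L]_d) (w : 'I_d -> bM3 D) :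
    s *: comb a w = comb a (fun j => s *: w j).
  rewrite scaler_sumr; apply: eq_bigr => j _.
  by rewrite !scalerA mulrC.
have prod_act (s s' : {mpoly L[n]}) (T T' : 'M[L]_d) :
    (forall j, s *: v j = comb (row j T) v) ->
    (forall j, s' *: v j = comb (row j T') v) ->
    forall j, (s' * s) *: v j = comb (row j (T *m T')) v.
  move=> e e' j; rewrite -scalerA e combs row_mul comb_mulmx.
  by apply: eq_bigr => i _; rewrite e'.
apply/row_matrixP => j; apply: (independent_inj iv).
rewrite !map_mxM -(prod_act _ _ _ _ act1 act2) -(prod_act _ _ _ _ act2 act1).
by rewrite mulrC.
Qed.

Lemma linear_comb (R : pzRingType) (U V : lmodType R) (l : {linear U -> V})
    (J : Type) (r : seq J) (c : J -> R) (x : J -> U) :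
  l (\sum_(j <- r) c j *: x j) = \sum_(j <- r) c j *: l (x j).
Proof. by rewrite linear_sum; apply: eq_bigr => j _; rewrite linearZ. Qed.

(** An equality of kernels carries relations between generators, and between
their products, from one triple to the other. *)
Section Equal.
Variables (A : comNzRingType) (D D' : bilin_triple n d r1 r2 A).
Hypothesis eqD : bilin_eq D D'.

Lemma bilin_eq_gen1 (p : 'I_d -> {mpoly A[n]}) i :
  independent (fun j => p j *: gen1 D' i) ->
  independent (fun j => p j *: gen1 D i).
Proof.
have [e1 _ _] := eqD; move=> ind a a0; apply: ind.
have cE (D0 : bilin_triple n d r1 r2 A) :
    bp1 D0 (comb a (fun j => p j *: delta_mx 0 i)) =
    comb a (fun j => p j *: gen1 D0 i).
  rewrite /comb linear_sum; apply: eq_bigr => j _; by rewrite linearZ linearZ.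
by rewrite -cE; apply/e1; rewrite cE.
Qed.

Let tm (D0 : bilin_triple n d r1 r2 A) :=
  tensor_map (bp1 D0) (bp2 D0).

Lemma tensor_map_linear (D0 : bilin_triple n d r1 r2 A) : linear (tm D0).
Proof.
apply: tensor_lift_is_linear.
- by move=> u u' v; rewrite linearD pureDl.
- by move=> u v v'; rewrite linearD pureDr.
- by move=> a u v; rewrite linearZ pureZl.
by move=> a u v; rewrite linearZ pureZr.
Qed.

Lemma bilin_eq_comb (J : Type) (r : seq J) (c : J -> {mpoly A[n]})
    (f : J -> 'I_r1) (g : J -> 'I_r2) :
  \sum_(j <- r) c j *: prodg D' (f j) (g j) = 0 ->
  \sum_(j <- r) c j *: prodg D (f j) (g j) = 0.
Proof.
have [_ _ e3] := eqD.
have cE (D0 : bilin_triple n d r1 r2 A) :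
    bpi D0 (tm D0 (\sum_(j <- r) c j *: pure (delta_mx 0 (f j)) (delta_mx 0 (g j)))) =
    \sum_(j <- r) c j *: prodg D0 (f j) (g j).
  pose lin := GRing.isLinear.Build _ _ _ *:%R (tm D0) (@tensor_map_linear D0).
  pose l : {linear tensor 'rV_r1 'rV_r2 -> tensor (bM1 D0) (bM2 D0)} :=
    HB.pack (tm D0) lin.
  apply: etrans (congr1 (bpi D0) (linear_comb l r c _)) _.
  rewrite linear_comb; apply: eq_bigr => j _.
  by rewrite /= /tm tensor_map_pure.
by move=> h; rewrite -cE; apply/e3; rewrite cE.
Qed.

End Equal.
End Triple.

(** * A cyclic and a noncommuting example *)

Section EvalModule.

(** The module [A^d] on which a polynomial acts on the [i]-th coordinate through
its value at the point [(t i, ..., t i)]. *)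
Definition evmod_of (n d : nat) (A : comNzRingType) (t : 'I_d -> A) : Type :=
  'rV[A]_d.

Variables (n d : nat) (A : comNzRingType) (t : 'I_d -> A).

Local Notation evmod := (evmod_of n t).
HB.instance Definition _ := GRing.Zmodule.on evmod.

Definition ev_scale (p : {mpoly A[n]}) (v : evmod) : evmod :=
  \row_i (p.@[fun=> t i] * (v : 'rV_d) 0 i).

Lemma ev_scaleA p q v : ev_scale p (ev_scale q v) = ev_scale (p * q) v.
Proof. by apply/rowP => i; rewrite !mxE mevalM mulrA. Qed.
Lemma ev_scale1 : left_id 1 ev_scale.
Proof. by move=> v; apply/rowP => i; rewrite !mxE meval1 mul1r. Qed.
Lemma ev_scaleDr : right_distributive ev_scale +%R.
Proof. by move=> p u v; apply/rowP => i; rewrite !mxE mulrDr. Qed.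
Lemma ev_scaleDl v : {morph ev_scale^~ v : p q / p + q}.
Proof. by move=> p q; apply/rowP => i; rewrite !mxE mevalD mulrDl. Qed.

HB.instance Definition _ := GRing.Zmodule_isLmodule.Build {mpoly A[n]} evmod
  ev_scaleA ev_scale1 ev_scaleDr ev_scaleDl.

Lemma ev_scaleE (p : {mpoly A[n]}) (v : evmod) i :
  (p *: v : 'rV_d) 0 i = p.@[fun=> t i] * (v : 'rV_d) 0 i.
Proof. by rewrite mxE. Qed.

Lemma ev_scaleC (c : A) (v : evmod) : c%:MP_[n] *: v = (c *: (v : 'rV_d) : 'rV_d).
Proof. by apply/rowP => i; rewrite ev_scaleE mevalC mxE. Qed.

Definition ev_std (i : 'I_d) : evmod := delta_mx 0 i.

Lemma comb_std (a : 'rV[A]_d) : comb a ev_std = (a : evmod).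
Proof.
rewrite [RHS]row_sum_delta; apply: eq_bigr => i _; exact: ev_scaleC.
Qed.

Lemma evmod_free : locally_free_rank d evmod.
Proof.
move=> p; exists 1; first exact: spec1.
exists ev_std; split=> [x|a a0].
  exists 0%N, ((x : 'rV_d) 0); rewrite expr0 mpolyC1 scale1r.
  exact: esym (comb_std x).
exists 0%N => i; rewrite expr0 mul1r.
have : comb (\row_i a i) ev_std = 0.
  by rewrite -[RHS]a0; apply: eq_bigr => j _; rewrite mxE.
by rewrite comb_std => /rowP /(_ i); rewrite !mxE.
Qed.

Variable i0 : 'I_d.

Definition ev_ones : evmod := (const_mx 1 : 'rV_d).

(** The basis that has the vector of ones in place of the [i0]-th unit vector:
the generator [e_0] is to be sent to the vector of ones, which generates the
module when the [t i] are distinct. *)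
Definition ev_frame (i : 'I_d) : evmod := if i == i0 then ev_ones else ev_std i.

Lemma ev_frame_span : spans ev_frame.
Proof.
move=> x; pose x0 : A := (x : 'rV_d) 0 i0.
pose y : evmod := x - x0%:MP *: ev_ones.
have y0 : (y : 'rV_d) 0 i0 = 0.
  by rewrite /y ev_scaleC !mxE mulr1 subrr.
exists (x0 *: delta_mx 0 i0 + (y : 'rV_d)); rewrite combD combZ comb_delta.
have -> : comb (y : 'rV_d) ev_frame = y.
  rewrite -[RHS]comb_std; apply: eq_bigr => i _.
  rewrite /ev_frame; case: eqP => // ->; by rewrite y0 mpolyC0 !scale0r.
by rewrite /ev_frame eqxx /y addrC subrK.
Qed.

End EvalModule.

Section Frame.
Variables (n d r : nat) (A : comNzRingType) (o : 'I_d -> 'I_r).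
Hypothesis o_inj : injective o.
Variables (M : lmodType {mpoly A[n]}) (b : 'I_d -> M).

Definition frame_map (v : 'rV[{mpoly A[n]}]_r) : M := \sum_i v 0 (o i) *: b i.

Lemma frame_map_linear : linear frame_map.
Proof.
move=> c u v; rewrite /frame_map scaler_sumr -big_split.
by apply: eq_bigr => i _ /=; rewrite !mxE scalerDl scalerA.
Qed.

HB.instance Definition _ := GRing.isLinear.Build {mpoly A[n]}
  'rV[{mpoly A[n]}]_r M *:%R frame_map frame_map_linear.

Lemma frame_map_delta i : frame_map (delta_mx 0 (o i)) = b i.
Proof.
rewrite /frame_map (bigD1 i) //= mxE !eqxx scale1r big1 ?addr0 // => j ji.
by rewrite mxE (inj_eq o_inj) (negbTE ji) andbF scale0r.
Qed.

Lemma frame_map_surj : spans b -> forall m, exists v, frame_map v = m.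
Proof.
move=> sb m; have [a ->] := sb m.
exists (\sum_i (a 0 i)%:MP *: delta_mx 0 (o i)).
rewrite linear_comb; by apply: eq_bigr => i _; rewrite /= frame_map_delta.
Qed.

End Frame.

(** An [S]-bilinear product on this module for which the vector of ones is a left
unit defines a point of Bilin; the unit makes [pi] surjective. *)
Section Build.
Variables (n d r1 r2 : nat) (A : comNzRingType) (t : 'I_d -> A) (i0 : 'I_d).
Variables (o1 : 'I_d -> 'I_r1) (o2 : 'I_d -> 'I_r2).
Hypotheses (o1_inj : injective o1) (o2_inj : injective o2).
Local Notation M := (evmod_of n t).
Variable b : M -> M -> M.
Hypotheses (bDl : forall x x' y, b (x + x') y = b x y + b x' y)
  (bDr : forall x y y', b x (y + y') = b x y + b x y')
  (bZl : forall a x y, b (a *: x) y = a *: b x y)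
  (bZr : forall a x y, b x (a *: y) = a *: b x y).
Hypothesis b1 : forall y, b (ev_ones n t) y = y.

Lemma ev_std_span : spans (ev_std n t).
Proof. by move=> x; exists x; rewrite comb_std. Qed.

Definition ev_pi : {linear tensor M M -> M} :=
  HB.pack (tensor_lift b) (GRing.isLinear.Build _ _ _ *:%R (tensor_lift b)
    (tensor_lift_is_linear bDl bDr bZl bZr)).

Lemma ev_pi_pure x y : ev_pi (pure x y) = b x y.
Proof. by rewrite /= tensor_lift_tsum // big_seq1. Qed.

Lemma ev_pi_surj y : exists z, ev_pi z = y.
Proof. by exists (pure (ev_ones n t) y); rewrite ev_pi_pure. Qed.

Definition ev_triple : bilin_triple n d r1 r2 A :=
  @BilinTriple n d r1 r2 A M M M
    (frame_map o1 (ev_frame n t i0)) (frame_map o2 (ev_std n t)) ev_pi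
    (frame_map_surj o1_inj (@ev_frame_span _ _ _ _ _))
    (frame_map_surj o2_inj ev_std_span) ev_pi_surj
    (@evmod_free _ _ _ _) (@evmod_free _ _ _ _) (@evmod_free _ _ _ _).

Lemma gen1_ev_triple i : gen1 ev_triple (o1 i) = ev_frame n t i0 i.
Proof. exact: frame_map_delta. Qed.

Lemma prodg_ev_triple i j :
  prodg ev_triple (o1 i) (o2 j) = b (ev_frame n t i0 i) (ev_std n t j).
Proof.
rewrite -ev_pi_pure; congr (ev_pi (pure _ _)); exact: frame_map_delta.
Qed.

End Build.

Section Cyclic.
Variables (n d r1 r2 : nat) (K : fieldType) (t : 'I_d -> K) (i0 : 'I_d) (v : 'I_n).
Variables (o1 : 'I_d -> 'I_r1) (o2 : 'I_d -> 'I_r2).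
Hypotheses (o1_inj : injective o1) (o2_inj : injective o2) (t_inj : injective t).

(** A relation is a polynomial of degree less than [d] that vanishes at the [d]
points [t i]. *)
Lemma powers_independent :
  independent (fun j : 'I_d => 'X_v ^+ j *: ev_ones n t).
Proof.
move=> a a0; pose p := \poly_(j < d) (if insub j is Some j then a 0 j else 0).
have pE (j : 'I_d) : p`_j = a 0 j.
  by rewrite coef_poly ltn_ord; case: insubP => [j' _ /val_inj -> //|/negP[]].
have p_root i : root p (t i).
  have /(congr1 (fun w : evmod_of n t => (w : 'rV_d) 0 i)) := a0.
  rewrite mxE /comb.
  have -> : \sum_j (a 0 j)%:MP *: ('X_v ^+ j *: ev_ones n t) =
     (\sum_j (a 0 j)%:MP * 'X_v ^+ j) *: ev_ones n t.
    by rewrite scaler_suml; apply: eq_bigr => j _; rewrite scalerA.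
  rewrite ev_scaleE mxE mulr1 => e; apply/rootP.
  rewrite -[RHS]e (horner_coef_wide _ (size_poly _ _)) raddf_sum.
  apply: eq_bigr => j _; rewrite pE /=.
  by rewrite mevalM mevalC rmorphXn /= mevalXU.
have p0 : p = 0.
  apply: (@roots_geq_poly_eq0 _ _ (codom t)).
  - by apply/allP => x /codomP[i ->].
  - by rewrite map_inj_uniq ?enum_uniq.
  by rewrite size_codom card_ord size_poly.
by apply/rowP => j; rewrite -pE p0 coef0 mxE.
Qed.

Lemma cyclic_triple : exists D : bilin_triple n d r1 r2 K,
  independent (fun j : 'I_d => 'X_v ^+ j *: gen1 D (o1 i0)).
Proof.
pose b (x y : evmod_of n t) : evmod_of n t := (\row_i (x 0 i * y 0 i) : 'rV_d).
have bDl x x' y : b (x + x') y = b x y + b x' y.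
  by apply/rowP => i; rewrite !mxE mulrDl.
have bDr x y y' : b x (y + y') = b x y + b x y'.
  by apply/rowP => i; rewrite !mxE mulrDr.
have bZl a x y : b (a *: x) y = a *: b x y.
  by apply/rowP => i; rewrite !mxE mulrA.
have bZr a x y : b x (a *: y) = a *: b x y.
  by apply/rowP => i; rewrite !mxE mulrCA.
have b1 y : b (ev_ones n t) y = y.
  by apply/rowP => i; rewrite !mxE mul1r.
exists (ev_triple i0 o1_inj o2_inj bDl bDr bZl bZr b1).
rewrite gen1_ev_triple /ev_frame eqxx; exact: powers_independent.
Qed.

End Cyclic.

Section NonCommuting.
Variables (n d r1 r2 : nat) (A : comNzRingType).
Variables (o1 : 'I_d -> 'I_r1) (o2 : 'I_d -> 'I_r2).
Hypotheses (o1_inj : injective o1) (o2_inj : injective o2).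
Variables (i0 i1 i2 : 'I_d) (i10 : i1 != i0) (i20 : i2 != i0) (i21 : i2 != i1).
Variables (T1 T2 : 'M[A]_d).

(** Let [S] act through evaluation at the origin, and let [x] act on [y] through
the matrix [act x], which is linear in [x] and takes the values [1], [T1], [T2] at
the vector of ones and at the unit vectors of index [i1], [i2]. *)
Lemma matrix_triple : exists D : bilin_triple n d r1 r2 A,
  let u j := prodg D (o1 i0) (o2 j) in
  [/\ independent u,
      forall j, prodg D (o1 i1) (o2 j) = comb (row j T1) u &
      forall j, prodg D (o1 i2) (o2 j) = comb (row j T2) u].
Proof.
pose t (i : 'I_d) : A := 0.
pose M := evmod_of n t.
pose act (x : 'rV[A]_d) : 'M[A]_d :=
  x 0 i0 *: 1%:M + (x 0 i1 - x 0 i0) *: T1 + (x 0 i2 - x 0 i0) *: T2.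
pose b (x y : M) : M := (y : 'rV_d) *m act x.
have scE (p : {mpoly A[n]}) (x : M) : p *: x = (p.@[fun=> 0] *: (x : 'rV_d) : 'rV_d).
  by apply/rowP => i; rewrite !mxE.
have actD x x' : act (x + x') = act x + act x'.
  by apply/matrixP => i j; rewrite !mxE; ring.
have actZ c x : act (c *: x) = c *: act x.
  by apply/matrixP => i j; rewrite !mxE; ring.
have bDl x x' y : b (x + x') y = b x y + b x' y by rewrite /b actD mulmxDr.
have bDr x y y' : b x (y + y') = b x y + b x y' by rewrite /b mulmxDl.
have bZl a x y : b (a *: x) y = a *: b x y by rewrite !scE /b actZ scalemxAr.
have bZr a x y : b x (a *: y) = a *: b x y by rewrite !scE /b scalemxAl.
have b1 y : b (ev_ones n t) y = y.
  by rewrite /b /act !mxE subrr !scale0r !addr0 scale1r mulmx1.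
exists (ev_triple i0 o1_inj o2_inj bDl bDr bZl bZr b1) => u.
have uE : u = ev_std n t.
  by apply: funext => j; rewrite /u prodg_ev_triple /ev_frame eqxx b1.
rewrite uE; split=> [a|j|j].
- by rewrite comb_std.
- rewrite prodg_ev_triple /ev_frame (negbTE i10) comb_std /b /act /ev_std.
  rewrite !mxE !eqxx eq_sym (negbTE i10) (negbTE i21) /=.
  by rewrite scale0r subr0 scale1r subrr scale0r addr0 add0r -rowE.
rewrite prodg_ev_triple /ev_frame (negbTE i20) comb_std /b /act /ev_std.
rewrite !mxE !eqxx eq_sym (negbTE i20) [i1 == i2]eq_sym (negbTE i21) /=.
by rewrite !subr0 !scale0r scale1r !add0r -rowE.
Qed.

End NonCommuting.

(** * Reducibility *)

Lemma bilin_eq_sym (n d r1 r2 : nat) (A : comNzRingType)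
    (D D' : bilin_triple n d r1 r2 A) : bilin_eq D D' -> bilin_eq D' D.
Proof.
by move=> [e1 e2 e3]; split=> [v|v|z]; split; first [move/e1 | move/e2 | move/e3].
Qed.

Section Transport.
Variables (n d r1 r2 : nat) (A : comNzRingType).
Variables (D D' : bilin_triple n d r1 r2 A).
Hypothesis eqD : bilin_eq D D'.

Lemma bilin_eq_independent i (o : 'I_d -> 'I_r2) :
  independent (fun j => prodg D' i (o j)) ->
  independent (fun j => prodg D i (o j)).
Proof.
move=> ind a a0; apply: ind.
exact: (bilin_eq_comb (bilin_eq_sym eqD) (f := fun=> i) (g := o) a0).
Qed.

(** Move everything to one side and list the terms: [None] stands for the
product that is expanded, [Some l] for the [l]-th term of its expansion. *)
Lemma bilin_eq_expand i i' j (o : 'I_d -> 'I_r2) a :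
  prodg D' i' j = comb a (fun j => prodg D' i (o j)) ->
  prodg D i' j = comb a (fun j => prodg D i (o j)).
Proof.
pose J := option 'I_d.
pose r : seq J := None :: map Some (index_enum 'I_d).
pose c (x : J) : {mpoly A[n]} := if x is Some l then - (a 0 l)%:MP else 1.
pose f (x : J) := if x is Some l then i else i'.
pose g (x : J) := if x is Some l then o l else j.
have cE (D0 : bilin_triple n d r1 r2 A) :
    \sum_(x <- r) c x *: prodg D0 (f x) (g x) =
    prodg D0 i' j - comb a (fun j => prodg D0 i (o j)).
  rewrite big_cons big_map scale1r; congr (_ + _).
  by rewrite /comb -sumrN; apply: eq_bigr => l _; rewrite scaleNr.
move=> e; apply/eqP; rewrite -subr_eq0 -cE; apply/eqP/(bilin_eq_comb eqD).
by rewrite cE e subrr.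
Qed.

End Transport.

(** [D'] is the fibre of [D] at the closed point of the local ring [B]. *)
Section ClosedFiber.
Variables (n d r1 r2 : nat) (B : comNzRingType) (K : fieldType).
Variables (phi : {rmorphism B -> K}).
Hypothesis phi_unit : forall b, phi b != 0 -> exists c, b * c = 1.
Variables (D : bilin_triple n d r1 r2 B) (D' : bilin_triple n d r1 r2 K).
Hypothesis pb : bilin_pullback phi D D'.

Lemma cyclic_of_fiber i (v : 'I_n) :
  independent (fun j : 'I_d => 'X_v ^+ j *: gen1 D' i) -> cyclic_at D i.
Proof.
move=> ind; have [h hE] := pullback_gen1 pb.
have sp : spans (fun j : 'I_d => 'X_v ^+ j *: gen1 D i).
  apply: (nakayama phi_unit (bM1_free D) (h := h)) => a a0; apply: ind.
  rewrite -[RHS]a0; apply: eq_bigr => j _.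
  by rewrite /= semilinearZ hE rmorphXn /= map_mpolyX.
move=> x; have [a ->] := sp x.
exists (\sum_j (a 0 j)%:MP * 'X_v ^+ j).
by rewrite scaler_suml; apply: eq_bigr => j _; rewrite scalerA.
Qed.

Lemma spans_of_fiber i (o : 'I_d -> 'I_r2) :
  independent (fun j => prodg D' i (o j)) -> spans (fun j => prodg D i (o j)).
Proof.
move=> ind; have [h hE] := pullback_prodg pb.
apply: (nakayama phi_unit (bM3_free D) (h := h)) => a a0; apply: ind.
by rewrite -[RHS]a0; apply: eq_bigr => j _; rewrite /= hE.
Qed.

Lemma lift_matrix i i' (o : 'I_d -> 'I_r2) (T : 'M[K]_d) :
  independent (fun j => prodg D' i (o j)) ->
  (forall j, prodg D' i' (o j) = comb (row j T) (fun j => prodg D' i (o j))) ->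
  exists2 T' : 'M[B]_d, map_mx phi T' = T &
    forall j, prodg D i' (o j) = comb (row j T') (fun j => prodg D i (o j)).
Proof.
move=> ind e; have [h hE] := pullback_prodg pb.
have [T' e'] := span_matrix (fun j => prodg D i' (o j)) (spans_of_fiber ind).
exists T' => //; apply/row_matrixP => j; apply: (independent_inj ind).
rewrite -e -hE e' comb_map map_row; apply: eq_bigr => l _ /=.
by rewrite hE.
Qed.

End ClosedFiber.

(** Euclid's argument: a root of [1 + prod_(c <- s) (X - c)] is not in [s]. *)
Lemma closed_field_uniq_seq (k : closedFieldType) (d : nat) :
  exists2 s : seq k, uniq s & size s = d.
Proof.
elim: d => [|d [s us sd]]; first by exists [::].
case: d sd => [|d] sd; first by exists [:: 0].
pose p : {poly k} := \prod_(c <- s) ('X - c%:P) + 1.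
have /closed_rootP[x] : size p != 1%N.
  by rewrite size_polyDl size_prod_XsubC ?size_poly1 sd.
rewrite /root hornerD hornerC => px; exists (x :: s); last by rewrite /= sd.
rewrite /= us andbT; apply/negP => xs; move: px.
by rewrite (rootP _) ?add0r ?oner_eq0 // root_prod_XsubC.
Qed.

Lemma closed_field_injection (k : closedFieldType) (d : nat) :
  exists t : 'I_d -> k, injective t.
Proof.
have [s us sd] := closed_field_uniq_seq k d.
exists (fun i => s`_i) => i j /eqP; rewrite nth_uniq ?sd //.
by move/eqP/val_inj.
Qed.

Theorem theorem3p19 (k : closedFieldType) (n d r1 r2 : nat)
    (n_ge1 : (1 <= n)%N) (d_le_r1 : (d <= r1)%N) (d_le_r2 : (d <= r2)%N)
    (d_ge3 : (3 <= d)%N)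
    (X : ringed_space) (sX : morphism X (Spec k))
    (X_scheme : is_scheme X)
    (X_represents : represents_Bilin n d r1 r2 sX) :
  ~ irreducible_space X.
Proof.
move=> X_irr; have [eta [_ eta_surj eta_nat]] := X_represents.
pose o1 := widen_ord d_le_r1; pose o2 := widen_ord d_le_r2.
have o1_inj : injective o1 by move=> i j /(congr1 val) /= /val_inj.
have o2_inj : injective o2 by move=> i j /(congr1 val) /= /val_inj.
pose i0 : 'I_d := Ordinal (leq_trans (isT : (0 < 3)%N) d_ge3).
pose i1 : 'I_d := Ordinal (leq_trans (isT : (1 < 3)%N) d_ge3).
pose i2 : 'I_d := Ordinal (leq_trans (isT : (2 < 3)%N) d_ge3).
have [t t_inj] := closed_field_injection k d.
have [D1 ind1] := cyclic_triple i0 (Ordinal n_ge1) o1_inj o2_inj t_inj.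
(* The two elementary matrices have product [E_00] in one order, [E_11] in the
   other. *)
pose T1 : 'M[k]_d := delta_mx i0 i1.
pose T2 : 'M[k]_d := delta_mx i1 i0.
have [D2 [ind2 e1 e2]] := matrix_triple n o1_inj o2_inj
  (isT : i1 != i0) (isT : i2 != i0) (isT : i2 != i1) T1 T2.
have [P eqP1] := eta_surj k^o D1.
have [Q eqQ2] := eta_surj k^o D2.
have [L [m [g [loc_m comm]]]] := common_generization X_scheme X_irr P Q.
have [B1 [f1 [phi1 [psi1 [unit1 P1 g1]]]]] := comm P (or_introl erefl).
have [B2 [f2 [phi2 [psi2 [unit2 Q2 g2]]]]] := comm Q (or_intror erefl).
have pb1 : bilin_pullback phi1 (eta B1 f1) (eta k^o P) by exact: eta_nat.
have pb2 : bilin_pullback phi2 (eta B2 f2) (eta k^o Q) by exact: eta_nat.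
have cyc : cyclic_at (eta B1 f1) (o1 i0).
  exact: (cyclic_of_fiber unit1 pb1 (bilin_eq_gen1 eqP1 ind1)).
have indQ := bilin_eq_independent eqQ2 ind2.
have [S1 S1E E1] := lift_matrix unit2 pb2 indQ
  (fun j => bilin_eq_expand eqQ2 (e1 j)).
have [S2 S2E E2] := lift_matrix unit2 pb2 indQ
  (fun j => bilin_eq_expand eqQ2 (e2 j)).
pose C := S1 *m S2 - S2 *m S1.
have phiC : phi2 (C i0 i0) = 1.
  transitivity ((T1 *m T2 - T2 *m T1) i0 i0).
    by rewrite -S1E -S2E -!map_mxM -map_mxB [RHS]mxE.
  by rewrite !mul_delta_mx !mxE !eqxx /= subr0.
have psiC : psi2 (C i0 i0) = 0.
  transitivity (map_mx psi2 C i0 i0); first by rewrite [RHS]mxE.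
  rewrite map_mxB (cyclic_commute loc_m (eta_nat _ _ psi1 _ _ g1)
    (eta_nat _ _ psi2 _ _ g2) cyc (spans_of_fiber unit2 pb2 indQ) E1 E2).
  by rewrite subrr mxE.
have [c Cc] : exists c, C i0 i0 * c = 1.
  by apply: unit2; rewrite phiC oner_neq0.
have : 1 = psi2 (C i0 i0) * psi2 c.
  by rewrite -[LHS](rmorph1 psi2) -Cc; apply: rmorphM.
by rewrite psiC mul0r => /eqP; rewrite oner_eq0.
Qed.
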